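(* Let $$M=\begin{pmatrix}3&1&-1&-4\\-1&2&0&0\\-2&-2&1&4\\3&2&-1&-5\end{pmatrix},$$ let $\lambda$ be the unique real positive eigenvalue of $M$ with $\lambda<1$ (its approximate value is $\lambda\approx0.254$), and let $(a,b,c,u)$ be an eigenvector of $M$ (as a column vector) with eigenvalue $\lambda$ and positive coordinates. Then the corresponding symmetric interval identification system $$S=\bigl([0,a+b+c];\ [0,a]\leftrightarrow[b+c,a+b+c],\ [0,b]\leftrightarrow[a+c,a+b+c],\ [u,u+c]\leftrightarrow[a+b-u,a+b+c-u]\bigr)$$ is of thin type. Approximate values of $(a,b,c,u)$ normalized by $a+b+c=1$ are equal to $(0.444,0.254,0.302,0.292)$.
   Context: **Interval identification systems.** An (oriented) interval identification system of order $n$ consists of a support interval $[A,B]$ and $n$ unordered pairs $\{[a_i,b_i],[c_i,d_i]\}$ of subintervals of $[A,B]$ with $b_i-a_i=d_i-c_i$, written $[a_i,b_i]\leftrightarrow[c_i,d_i]$. The system is *symmetric* if $a_i-A=B-d_i$ for every $i=1,\ldots,n$. For $x,y\in[A,B]$ write $x\leftrightarrow_i y$ if there is $t\in[0,1]$ with $\{x,y\}=\{a_i+t(b_i-a_i),\,c_i+t(d_i-c_i)\}$. **Graph and orbits.** To a system $S$ one associates the graph $\Gamma(S)$ whose vertices are all points of the support interval, two vertices $x,y$ being connected by an edge if and only if they are identified by the system, i.e. $x\leftrightarrow_i y$ for some $i$. The connected component containing the vertex $x$ is denoted $\Gamma_x(S)$. Its set of vertices is the orbit of $x$ in $S$. **Equivalence.**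 For $t\in\mathbb{R}$, $S+t$ denotes the system $S$ translated by $t$. Two interval identification systems $S_1,S_2$ with supports $[A_1,B_1]$, $[A_2,B_2]$ are *equivalent* if there are $t\in\mathbb{R}$ and an interval $[A,B]\subset[A_1,B_1]\cap[A_2+t,B_2+t]$ such that: 1. every orbit of each of the systems $S_1$ and $S_2+t$ contains a point of $[A,B]$; 2. for each $x\in[A,B]$ the graphs $\Gamma_x(S_1)$ and $\Gamma_x(S_2+t)$ are homotopy equivalent through mappings that are identical on $[A,B]$ and such that the full preimage of each vertex contains only finitely many vertices of the other graph. **Thin type.** An interval identification system $S$ is *of thin type* if an equivalent system may have arbitrarily small support: for every $\varepsilon>0$ there is an interval identification system equivalent to $S$ whose support interval has length less than $\varepsilon$. *)

(* Defs.v *)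
From HB Require Import structures.
From Stdlib Require Import Relation_Operators.
From mathcomp Require Import all_boot all_order all_algebra.
From mathcomp Require Import all_classical all_reals all_analysis.

Set Implicit Arguments.
Unset Strict Implicit.
Unset Printing Implicit Defensive.

Import Order.TTheory GRing.Theory Num.Theory numFieldNormedType.Exports.

Local Open Scope classical_set_scope.
Local Open Scope ring_scope.

(** There is at most one edge between two vertices. Loops are allowed. *)
Record graph (R : realType) := Graph {
  vertices : set R;
  adjacent : R -> R -> Prop;
  adjacent_sym : forall x y, adjacent x y -> adjacent y x
}.

(** An edge is an unordered pair, encoded by listing its smaller end first. *)
Definition edges (R : realType) (G : graph R) : set (R * R) :=
  [set e | [/\ vertices G e.1, vertices G e.2, e.1 <= e.2
             & adjacent G e.1 e.2]].

Definition component (R : realType) (G : graph R) (x : R) : graph R :=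
  {| vertices := vertices G `&`
       [set y | clos_refl_trans R
          (fun p q => [/\ vertices G p, vertices G q & adjacent G p q]) x y];
     adjacent := adjacent G;
     adjacent_sym := @adjacent_sym R G |}.

Section Realization.
Variables (R : realType) (G : graph R).

Variant realization : Type :=
  | Vertex of vertices G
  | Inner of edges G & (`]0%R, 1%R[%classic : set R).

Lemma edge_ends (e : edges G) :
  (val e).1 \in vertices G /\ (val e).2 \in vertices G.
Proof. by case: e => e /= /set_mem[? ? _ _]; split; apply/mem_set. Qed.

Definition edge_src (e : edges G) : vertices G := exist _ (val e).1 (edge_ends e).1.
Definition edge_tgt (e : edges G) : vertices G := exist _ (val e).2 (edge_ends e).2.

(** The characteristic map [0, 1] -> |G| of an edge, precomposed with the
    retraction of the line onto [0, 1]. *)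
Definition cell (e : edges G) (t : R) : realization :=
  if insub t is Some s then Inner e s
  else if t <= 0 then Vertex (edge_src e) else Vertex (edge_tgt e).

(** The weak topology of the 1-dimensional CW complex. Since [0, 1] is a
    retract of the line, openness of the preimage by [cell e] in the line
    amounts to openness of the preimage by the characteristic map in [0, 1]. *)
Definition realization_open (U : set realization) : Prop :=
  forall e : edges G, open (cell e @^-1` U).

HB.instance Definition _ := gen_eqMixin realization.
HB.instance Definition _ := gen_choiceMixin realization.

Let realization_openT : realization_open setT.
Proof. by move=> e; rewrite preimage_setT; exact: openT. Qed.

Let realization_openI (U V : set realization) :
  realization_open U -> realization_open V -> realization_open (U `&` V).
Proof. by move=> oU oV e; rewrite preimage_setI; apply: openI. Qed.

Let realization_open_bigU (I : Type) (f : I -> set realization) :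
  (forall i, realization_open (f i)) -> realization_open (\bigcup_i f i).
Proof.
by move=> of_ e; rewrite preimage_bigcup; apply: bigcup_open => i _; apply: of_.
Qed.

HB.instance Definition _ := @isOpenTopological.Build realization
  realization_open realization_openT realization_openI realization_open_bigU.

End Realization.

Definition homotopic (R : realType) (X Y : topologicalType) (f g : X -> Y) :
    Prop :=
  exists H : X * R -> Y,
    [/\ {within [set: X] `*` `[0%R, 1%R], continuous H},
        forall x, H (x, 0) = f x & forall x, H (x, 1) = g x].

Definition homotopy_inverse (R : realType) (X Y : topologicalType)
    (f : X -> Y) (g : Y -> X) : Prop :=
  [/\ continuous f, continuous g,
      homotopic R (g \o f) id & homotopic R (f \o g) id].

(** In particular every vertex of [G1] lying in [A] must be a vertex of [G2]. *)
Definition identical_on (R : realType) (A : set R) (G1 G2 : graph R)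
    (f : realization G1 -> realization G2) : Prop :=
  forall v : vertices G1, A (val v) ->
    exists2 w : vertices G2, val w = val v & f (Vertex v) = Vertex w.

(** The preimage of a vertex may contain inner points of edges as well; only
    the vertices in it are required to be finite in number. *)
Definition finite_vertex_fibers (R : realType) (G1 G2 : graph R)
    (f : realization G1 -> realization G2) : Prop :=
  forall w : vertices G2,
    finite_set [set v : vertices G1 | f (Vertex v) = Vertex w].

Definition graph_equivalent (R : realType) (A : set R) (G1 G2 : graph R) :
    Prop :=
  exists (f : realization G1 -> realization G2)
         (g : realization G2 -> realization G1),
    [/\ homotopy_inverse R f g,
        identical_on A f /\ identical_on A g
      & finite_vertex_fibers f /\ finite_vertex_fibers g].

(** The pair [pa, pb] <-> [pc, pd]; the order of the two intervals is immaterial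
    in everything below, [symmetric_iis] included since their lengths agree. *)
Record ipair (R : realType) :=
  IPair { pa : R; pb : R; pc : R; pd : R }.

Record iis (R : realType) (n : nat) := IIS {
  lo : R;
  hi : R;
  pairs : 'I_n -> ipair R
}.

Section Systems.
Variable R : realType.

Definition support_interval n (S : iis R n) : set R := `[lo S, hi S].

Definition is_iis n (S : iis R n) : Prop :=
  lo S < hi S /\
  forall i, let p := pairs S i in
    [/\ pa p < pb p, pc p < pd p, pb p - pa p = pd p - pc p,
        `[pa p, pb p] `<=` support_interval S
      & `[pc p, pd p] `<=` support_interval S].

Definition symmetric_iis n (S : iis R n) : Prop :=
  forall i, pa (pairs S i) - lo S = hi S - pd (pairs S i).

Definition identified_by (p : ipair R) (x y : R) : Prop :=
  exists2 t : R, 0 <= t <= 1 &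
    [set x; y] = [set pa p + t * (pb p - pa p); pc p + t * (pd p - pc p)].

Definition identified n (S : iis R n) (x y : R) : Prop :=
  exists i, identified_by (pairs S i) x y.

Lemma identified_sym n (S : iis R n) x y :
  identified S x y -> identified S y x.
Proof. by move=> [i [t t01 E]]; exists i, t => //; rewrite setUC. Qed.

Definition Gamma n (S : iis R n) : graph R :=
  {| vertices := support_interval S;
     adjacent := identified S;
     adjacent_sym := @identified_sym n S |}.

Definition iis_orbit n (S : iis R n) (x : R) : set R :=
  vertices (component (Gamma S) x).

Definition translate n (S : iis R n) (t : R) : iis R n :=
  {| lo := lo S + t;
     hi := hi S + t;
     pairs i := let p := pairs S i in
       IPair (pa p + t) (pb p + t) (pc p + t) (pd p + t) |}.

Definition equivalent n1 n2 (S1 : iis R n1) (S2 : iis R n2) : Prop :=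
  exists t A B : R, let S2t := translate S2 t in
    [/\ A < B,
        `[A, B] `<=` support_interval S1 `&` support_interval S2t,
        (forall x, support_interval S1 x -> iis_orbit S1 x `&` `[A, B] !=set0) /\
        (forall x, support_interval S2t x -> iis_orbit S2t x `&` `[A, B] !=set0)
      & forall x, `[A, B]%classic x ->
          graph_equivalent `[A, B]
            (component (Gamma S1) x) (component (Gamma S2t) x)].

Definition thin_type n (S : iis R n) : Prop :=
  forall eps : R, 0 < eps ->
    exists (m : nat) (S' : iis R m),
      [/\ is_iis S', equivalent S S' & hi S' - lo S' < eps].

Definition thinM : 'M[R]_4 :=
  \matrix_(i, j) nth 0 (nth [::]
    [:: [::  3;  1; -1; -4];
        [:: -1;  2;  0;  0];
        [:: -2; -2;  1;  4];
        [::  3;  2; -1; -5]] i) j.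

Definition col4 (a b c u : R) : 'cV[R]_4 := \col_i nth 0 [:: a; b; c; u] i.

Definition S_abcu (a b c u : R) : iis R 3 :=
  {| lo := 0;
     hi := a + b + c;
     pairs := tnth [tuple IPair 0 a (b + c) (a + b + c);
                          IPair 0 b (a + c) (a + b + c);
                          IPair u (u + c) (a + b - u) (a + b + c - u)] |}.

End Systems.

(* Main.v *)
(** Cutting off the right end of the support, after sliding along the longest
    pair ending there the other pair ending there, changes neither the orbits
    nor the homotopy types of their graphs: a slide moves one end of each edge of
    a pair along an edge of another pair, and the cut then removes leaves. Six
    such moves turn the system with parameters [(a, b, c, u)] into the system
    with parameters [M (a, b, c, u)], with no translation. For an eigenvector this
    is the same system scaled by [lambda], and [lambda *: (a, b, c, u)] is again an
    eigenvector, so that iterating makes the support arbitrarily short. *)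

Require Import Defs.
From Stdlib Require Import Relation_Operators.
From mathcomp Require Import all_boot all_order all_algebra.
From mathcomp Require Import all_classical all_reals all_analysis.
From mathcomp Require Import ring lra.

Set Implicit Arguments.
Unset Strict Implicit.
Unset Printing Implicit Defensive.

Import Order.TTheory GRing.Theory Num.Theory numFieldNormedType.Exports.
Local Open Scope classical_set_scope.
Local Open Scope ring_scope.

(* MathComp-Analysis reuses the name. *)
Local Notation adjacent := Defs.adjacent.

(** * Homotopies over the line *)

Section Paths.
Variable R : realType.

(** [Gamma] has at most one edge between two points, so a slide could turn a moved edge into a loop
    or merge it with another edge, and so change the homotopy type. This is why the moves require
    the three translations to stay nonzero and, up to sign, apart. These requirements, like the
    containments between intervals, are linear in [a], [b], [c], [u]; they follow from rational
    bounds on [a / b], [c / b] and [u / b], which in turn come from a tight rational enclosure of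
    [lambda]. The bounds are invariant under scaling, so one renormalization step serves for all
    iterates.

    On the topological side, orbits may be infinite, and the homotopies move infinitely many edges
    at once. They are therefore defined edge by edge, which demands that the product of the weak
    topology with the line be again determined by the cells. *)

Lemma continuous_if_le (T U : topologicalType) (h : T -> R) (c : R)
    (f g : T -> U) :
  continuous h -> continuous f -> continuous g ->
  (forall x, h x = c -> f x = g x) ->
  continuous (fun x => if h x <= c then f x else g x).
Proof.
move=> ch cf cg fg.
have cl (A : set R) : closed A -> closed (h @^-1` A).
  by move=> cA; move/continuous_closedP: ch; apply.
apply/continuous_subspace_setT.
have -> : [set: T] = (h @^-1` [set y | y <= c]) `|` (h @^-1` [set y | c <= y]).
  by apply/seteqP; split => // x _ /=; case: (leP (h x) c); [left|right; apply: ltW].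
apply: withinU_continuous.
- exact: cl (@closed_le _ _).
- exact: cl (@closed_ge _ _).
- apply: (@subspace_eq_continuous _ _ _ f); last exact: continuous_subspaceT.
  by move=> x /set_mem /= hx; rewrite /from_subspace hx.
- apply: (@subspace_eq_continuous _ _ _ g); last exact: continuous_subspaceT.
  move=> x /set_mem /= hx; rewrite /from_subspace; case: leP => // hx'.
  by rewrite fg //; apply/eqP; rewrite eq_le hx hx'.
Qed.

(** The retraction of the line onto [0, 1], written with absolute values to make its continuity
    immediate. *)
Definition clip (t : R) : R := (1 + `|t| - `|t - 1|) / 2.

Lemma clip_id t : 0 <= t <= 1 -> clip t = t.
Proof.
move=> /andP[t0 t1]; rewrite /clip ger0_norm// ler0_norm; first by field.
by rewrite subr_le0.
Qed.

Lemma clip_le0 t : t <= 0 -> clip t = 0.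
Proof.
move=> t0; rewrite /clip !ler0_norm//; last lra.
by field.
Qed.

Lemma clip_ge1 t : 1 <= t -> clip t = 1.
Proof.
move=> t1; rewrite /clip !ger0_norm//; [by field|lra|lra].
Qed.

Lemma clip_bounds t : 0 <= clip t <= 1.
Proof.
case: (leP t 0) => [/clip_le0->|t0]; first lra.
case: (leP t 1) => [t1|/ltW/clip_ge1->]; last lra.
by rewrite clip_id; lra.
Qed.

Lemma clip_continuous : continuous clip.
Proof.
move=> t; apply: cvgM; last exact: cvg_cst.
apply: cvgB.
  by apply: cvgD; [exact: cvg_cst|exact: norm_continuous].
apply: (@cvg_comp _ _ _ (fun t => t - 1) (fun t => `|t|)); last exact: norm_continuous.
by apply: cvgB; [exact: cvg_id|exact: cvg_cst].
Qed.

(** The tube lemma for the compact segment [[a, b]]. *)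
Lemma tube_open (Y : topologicalType) (h : R * R -> Y) (W : set Y) (a b : R) :
  continuous h -> open W ->
  open [set t | forall s, `[a, b]%classic s -> W (h (t, s))].
Proof.
move=> ch oW; rewrite openE => t /= tW.
have := @segment_compact _ a b => /compact_near_coveringP.
move=> /(_ R (nbhs t) (fun t' s => W (h (t', s)))) H.
apply: H => s abs.
have : nbhs (t, s) (h @^-1` W).
  by apply: ch; apply: open_nbhs_nbhs; split => //; apply: tW.
case=> -[A B] /= [At Bs] AB.
exists (B, A) => //= -[s' t'] /= [Bs' At'].
exact: (AB (t', s')).
Qed.

(** Continuity is asked on all of [X * R], so that gluing and reparametrizing homotopies never
    involves a subspace topology. *)
Definition homot (X Y : topologicalType) (f g : X -> Y) : Prop :=
  exists H : X * R -> Y,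
    [/\ continuous H, forall x, H (x, 0) = f x & forall x, H (x, 1) = g x].

Lemma homot_homotopic (X Y : topologicalType) (f g : X -> Y) :
  homot f g -> homotopic R f g.
Proof.
by case=> H [cH H0 H1]; exists H; split => //; apply: continuous_subspaceT.
Qed.

Lemma homot_refl (X Y : topologicalType) (f : X -> Y) :
  continuous f -> homot f f.
Proof.
move=> cf; exists (f \o fst); split => // x.
by apply: continuous_comp; [exact: cvg_fst|exact: cf].
Qed.

Lemma homot_compl (X Y Z : topologicalType) (f g : X -> Y) (h : Y -> Z) :
  continuous h -> homot f g -> homot (h \o f) (h \o g).
Proof.
move=> ch [H [cH H0 H1]]; exists (h \o H); split => [x|x|x] /=.
- by apply: continuous_comp; [exact: cH|exact: ch].
- by rewrite H0.
- by rewrite H1.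
Qed.

Lemma pair_continuous (T U V : topologicalType) (f : T -> U) (g : T -> V) :
  continuous f -> continuous g -> continuous (fun x => (f x, g x)).
Proof. by move=> cf cg x; apply: cvg_pair; [exact: cf|exact: cg]. Qed.

Lemma homot_compr (X Y Z : topologicalType) (f g : X -> Y) (h : Z -> X) :
  continuous h -> homot f g -> homot (f \o h) (g \o h).
Proof.
move=> ch [H [cH H0 H1]].
exists (fun p => H (h p.1, p.2)); split => [|x|x] /=; rewrite ?H0 ?H1 //.
move=> p; apply: (@continuous_comp _ _ _ (fun p : Z * R => (h p.1, p.2)) H).
  apply: pair_continuous => q; last exact: cvg_snd.
  by apply: continuous_comp; [exact: cvg_fst|exact: ch].
exact: cH.
Qed.

Lemma scale_add_continuous (a b : R) : continuous (fun t : R => a * t + b).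
Proof.
move=> t; apply: cvgD; last exact: cvg_cst.
by apply: cvgM; [exact: cvg_cst|exact: cvg_id].
Qed.

Lemma homot_trans (X Y : topologicalType) (f g h : X -> Y) :
  homot f g -> homot g h -> homot f h.
Proof.
move=> [H [cH H0 H1]] [K [cK K0 K1]].
pose L p := if p.2 <= 1 / 2 then H (p.1, 2 * p.2 + 0) else K (p.1, 2 * p.2 + -1).
have c2 (a b : R) : continuous (fun p : X * R => (p.1, a * p.2 + b)).
  apply: pair_continuous => p; first exact: cvg_fst.
  apply: (@continuous_comp _ _ _ snd (fun t => a * t + b)); first exact: cvg_snd.
  exact: scale_add_continuous.
exists L; split => [|x|x].
- apply: continuous_if_le => [p|p|p|[x t] /= ->]; first exact: cvg_snd.
  + apply: (@continuous_comp _ _ _ (fun p : X * R => (p.1, 2 * p.2 + 0)) H);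
      [exact: c2|exact: cH].
  + apply: (@continuous_comp _ _ _ (fun p : X * R => (p.1, 2 * p.2 + -1)) K);
      [exact: c2|exact: cK].
  + have -> : 2 * (1 / 2) + 0 = 1 :> R by field.
    have -> : 2 * (1 / 2) + -1 = 0 :> R by field.
    by rewrite H1 K0.
- by rewrite /L /= ifT ?mulr0 ?addr0 ?H0//; lra.
- rewrite /L /= ifF; last by apply/negbTE; rewrite -ltNge; lra.
  by rewrite -(K1 x); congr (K (_, _)); lra.
Qed.

End Paths.

(** * Maps out of the realization of a graph *)

Section Cells.
Variables (R : realType) (G : graph R).
Implicit Types (e : edges G) (t : R) (u v : vertices G).

Lemma cell_le0 e t : t <= 0 -> cell e t = Vertex (edge_src e).
Proof.
move=> t0; rewrite /cell insubF ?t0//; apply/negbTE/negP => /set_mem /=.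
by rewrite in_itv /= ltNge t0.
Qed.

Lemma cell_ge1 e t : 1 <= t -> cell e t = Vertex (edge_tgt e).
Proof.
move=> t1; rewrite /cell insubF ?ifF//; first by apply/negbTE; rewrite -ltNge; lra.
apply/negbTE/negP => /set_mem /=.
by rewrite in_itv /= [t < 1]ltNge t1 andbF.
Qed.

Lemma cell_inner e (s : (`]0%R, 1%R[%classic : set R)) : cell e (val s) = Inner e s.
Proof. by rewrite /cell valK. Qed.

Lemma inner_bounds (s : (`]0%R, 1%R[%classic : set R)) : 0 < val s < 1.
Proof. by case: s => s /= /set_mem /=; rewrite in_itv. Qed.

Lemma cell_clip e t : cell e (clip t) = cell e t.
Proof.
have [t0|t0] := leP t 0; first by rewrite clip_le0 // !cell_le0.
have [t1|t1] := leP t 1; first by rewrite clip_id //; lra.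
by rewrite clip_ge1 ?ltW// cell_ge1 // cell_ge1 // ltW.
Qed.

Lemma openE_realization (U : set (realization G)) : open U = realization_open U.
Proof. by []. Qed.

Lemma cell_continuous e : continuous (cell e).
Proof. by apply/continuousP => U oU; exact: oU. Qed.

Lemma continuous_cells (Y : topologicalType) (f : realization G -> Y) :
  (forall e, continuous (f \o cell e)) -> continuous f.
Proof.
move=> cf; apply/continuousP => U oU; rewrite openE_realization => e.
by move/continuousP: (cf e); apply.
Qed.

(* The product with the line still carries the topology determined by the
   cells, because closed bounded intervals are compact. *)
Lemma continuous_cells_prod (Y : topologicalType) (H : realization G * R -> Y) :
  (forall v, continuous (fun s => H (Vertex v, s))) ->
  (forall e, continuous (fun p : R * R => H (cell e p.1, p.2))) ->
  continuous H.
Proof.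
move=> cv ce [x s].
have cs : continuous (fun s => H (x, s)).
  case: x => [v|e r]; first exact: cv.
  move=> s'; rewrite -cell_inner.
  apply: (@continuous_comp _ _ _ (fun s => (val r, s)) (fun p : R * R => H (cell e p.1, p.2))).
    by apply: pair_continuous => z; [exact: cvg_cst|exact: cvg_id].
  exact: ce.
move=> W; rewrite nbhsE => -[U [oU Uxs] UW].
have : nbhs s ((fun s => H (x, s)) @^-1` U).
  by apply: cs; apply: open_nbhs_nbhs.
move=> /nbhs_ballP[d d0 dU].
have [d' [d'0 d'U]] : exists d' : R, 0 < d' /\
    forall s', `[s - d', s + d']%classic s' -> U (H (x, s')).
  exists (d / 2); split; first by rewrite divr_gt0.
  move=> s' /=; rewrite in_itv /= => /andP[s1 s2]; apply: dU.
  have d0' : 0 < d by [].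
  by rewrite /ball /= ltr_norml; apply/andP; split; lra.
(* The points whose whole track over a closed time segment stays in [U]. On each cell this is an
   open set by [tube_open], so [A] times the open time interval is the required box. *)
pose A := [set y | forall s', `[s - d', s + d']%classic s' -> U (H (y, s'))].
have oA : open A.
  by rewrite openE_realization => e; exact: (@tube_open _ _ (fun p : R * R => H (cell e p.1, p.2))).
exists (A, `]s - d', s + d'[%classic) => /=.
  split; first exact: open_nbhs_nbhs.
  by apply: open_nbhs_nbhs; split; [exact: interval_open|rewrite /= in_itv /=; lra].
move=> [y s'] /= [Ay]; rewrite in_itv /= => /andP[s1 s2]; apply: UW.
by apply: Ay; rewrite /= in_itv /= !ltW.
Qed.

Lemma map_of_cells (Y : topologicalType) (fv : vertices G -> Y)
    (fe : edges G -> R -> Y) :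
  (forall e, continuous (fe e)) ->
  (forall e, fe e 0 = fv (edge_src e)) -> (forall e, fe e 1 = fv (edge_tgt e)) ->
  exists f : realization G -> Y,
    [/\ continuous f, forall v, f (Vertex v) = fv v
      & forall e t, 0 <= t <= 1 -> f (cell e t) = fe e t].
Proof.
move=> ce e0 e1.
pose f x := match x with Vertex v => fv v | Inner e s => fe e (val s) end.
have fE e t : 0 <= t <= 1 -> f (cell e t) = fe e t.
  move=> /andP[]; rewrite le_eqVlt => /orP[/eqP<- _|t0]; first by rewrite cell_le0 /= ?e0.
  rewrite le_eqVlt => /orP[/eqP->|t1]; first by rewrite cell_ge1 /= ?e1.
  have tin : t \in (`]0%R, 1%R[%classic : set R) by apply/mem_set; rewrite /= in_itv /= t0.
  by rewrite -[t]/(val (exist _ t tin : (`]0%R, 1%R[%classic : set R))) cell_inner.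
exists f; split => //; apply: continuous_cells => e.
have -> : f \o cell e = fe e \o (@clip R).
  by apply/funext => t /=; rewrite -cell_clip fE // clip_bounds.
by move=> t; apply: continuous_comp; [exact: clip_continuous|exact: ce].
Qed.

Lemma homot_of_cells (Y : topologicalType) (f0 f1 : realization G -> Y)
    (hv : vertices G -> R -> Y) :
  (forall v, continuous (hv v)) ->
  (forall v, hv v 0 = f0 (Vertex v)) -> (forall v, hv v 1 = f1 (Vertex v)) ->
  (forall e, exists he : R * R -> Y,
    [/\ continuous he,
        forall s, he (0, s) = hv (edge_src e) s /\ he (1, s) = hv (edge_tgt e) s
      & forall t, 0 <= t <= 1 ->
          he (t, 0) = f0 (cell e t) /\ he (t, 1) = f1 (cell e t)]) ->
  homot R f0 f1.
Proof.
move=> chv hv0 hv1 /choice[he heP].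
have che e : continuous (he e) by case: (heP e).
have he0 e s : he e (0, s) = hv (edge_src e) s by case: (heP e) => _ /(_ s)[].
have he1 e s : he e (1, s) = hv (edge_tgt e) s by case: (heP e) => _ /(_ s)[].
pose H (p : realization G * R) :=
  match p.1 with Vertex v => hv v p.2 | Inner e s => he e (val s, p.2) end.
have HE e t s : 0 <= t <= 1 -> H (cell e t, s) = he e (t, s).
  move=> /andP[]; rewrite le_eqVlt => /orP[/eqP<- _|t0]; first by rewrite cell_le0 /H /= ?he0.
  rewrite le_eqVlt => /orP[/eqP->|t1]; first by rewrite cell_ge1 /H /= ?he1.
  have tin : t \in (`]0%R, 1%R[%classic : set R) by apply/mem_set; rewrite /= in_itv /= t0.
  by rewrite -[t]/(val (exist _ t tin : (`]0%R, 1%R[%classic : set R))) cell_inner.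
have inner_le (s : (`]0%R, 1%R[%classic : set R)) : 0 <= val s <= 1.
  by have := inner_bounds s; lra.
exists H; split => [|[v|e s]|[v|e s]].
- apply: continuous_cells_prod => [v|e]; first exact: chv.
  have -> : (fun p : R * R => H (cell e p.1, p.2)) =
            he e \o (fun p : R * R => (clip p.1, p.2)).
    by apply/funext => p /=; rewrite -cell_clip HE // clip_bounds.
  move=> p; apply: continuous_comp; last exact: che.
  apply: (@pair_continuous _ _ _ (fun p : R * R => clip p.1)) => q; last exact: cvg_snd.
  by apply: continuous_comp; [exact: cvg_fst|exact: clip_continuous].
- by rewrite /H /= hv0.
- by case: (heP e) => _ _ /(_ _ (inner_le s))[]; rewrite /H /= cell_inner.
- by rewrite /H /= hv1.
- by case: (heP e) => _ _ /(_ _ (inner_le s))[]; rewrite /H /= cell_inner.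
Qed.

(** Edges are stored with the smaller end first, while slides and collapses know an edge by its ends
    in either order; [seg u v] runs from [u] to [v] in both cases. Without an edge it is constant at
    [u], so continuity holds unconditionally. *)
Definition seg u v t : realization G :=
  if insub (val u, val v) is Some e then cell e t
  else if insub (val v, val u) is Some e then cell e (1 - t) else Vertex u.

Lemma edgeE e : val e = (val (edge_src e), val (edge_tgt e)).
Proof. by case: e => -[]. Qed.

Lemma cell_seg e t : cell e t = seg (edge_src e) (edge_tgt e) t.
Proof. by rewrite /seg -edgeE valK. Qed.

Lemma segP u v : val u <> val v -> adjacent G (val u) (val v) ->
  exists e,
   [/\ edge_src e = u, edge_tgt e = v, forall t, seg u v t = cell e t
     & forall t, seg v u t = cell e (1 - t)] \/
   [/\ edge_src e = v, edge_tgt e = u, forall t, seg u v t = cell e (1 - t)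
     & forall t, seg v u t = cell e t].
Proof.
wlog uv : u v / val u < val v => [hwlog neq adj|neq adj].
  have [uv|vu|//] := ltgtP (val u) (val v); first exact: hwlog.
  have [] := hwlog v u vu; [exact: nesym|exact: adjacent_sym|].
  by move=> e [[? ? ? ?]|[? ? ? ?]]; exists e; [right|left]; split.
have He : (val u, val v) \in edges G.
  by apply/mem_set; split => /=; [exact: set_mem (valP u)|exact: set_mem (valP v)|exact: ltW|].
pose e : edges G := exist _ (val u, val v) He.
exists e; left; split; [exact: val_inj|exact: val_inj|move=> t|move=> t].
  by rewrite /seg -[(val u, val v)]/(val e) valK.
rewrite /seg insubF; first by rewrite -[(val u, val v)]/(val e) valK.
by apply/negP => /set_mem[_ _ /=]; rewrite leNgt uv.
Qed.

Lemma one_sub_continuous : continuous (fun t : R => 1 - t).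
Proof. by move=> t; apply: cvgB; [exact: cvg_cst|exact: cvg_id]. Qed.

Lemma seg_continuous u v : continuous (seg u v).
Proof.
rewrite /seg; case: insubP => [e _ _|_]; first exact: cell_continuous.
case: insubP => [e _ _|_]; last by move=> t; exact: cvg_cst.
move=> t; apply: (@continuous_comp _ _ _ (fun t => 1 - t) (cell e)).
  exact: one_sub_continuous.
exact: cell_continuous.
Qed.

Section Adjacent.
Variables u v : vertices G.
Hypotheses (uv : val u <> val v) (adj : adjacent G (val u) (val v)).

Lemma seg_le0 t : t <= 0 -> seg u v t = Vertex u.
Proof.
move=> t0; have [e [[<- _ -> _]|[_ <- -> _]]] := segP uv adj.
  by rewrite cell_le0.
by rewrite cell_ge1 //; lra.
Qed.

Lemma seg_ge1 t : 1 <= t -> seg u v t = Vertex v.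
Proof.
move=> t0; have [e [[_ <- -> _]|[<- _ -> _]]] := segP uv adj.
  by rewrite cell_ge1.
by rewrite cell_le0 //; lra.
Qed.

Lemma seg_rev t : seg v u t = seg u v (1 - t).
Proof.
have [e [[_ _ Eu Ev]|[_ _ Eu Ev]]] := segP uv adj; first by rewrite Eu Ev.
by rewrite Eu Ev; congr cell; lra.
Qed.

End Adjacent.
End Cells.

Section Join.
Variables (R : realType) (Y : topologicalType).

(** Concatenation without rescaling, parametrized by [0, 2]: the corner sits at 1, and a speed is
    supplied at each use. *)
Definition join_path (p q : R -> Y) (t : R) : Y := if t <= 1 then p t else q (t - 1).

Lemma join_path_continuous (p q : R -> Y) : continuous p -> continuous q ->
  p 1 = q 0 -> continuous (join_path p q).
Proof.
move=> cp cq pq; apply: (@continuous_if_le R) => [t|//|t|t ->]; first exact: cvg_id.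
- apply: (@continuous_comp _ _ _ (fun t : R => t - 1) q); last exact: cq.
  by apply: cvgB; [exact: cvg_id|exact: cvg_cst].
- by rewrite subrr.
Qed.

Lemma join_path_ge1 (p q : R -> Y) t : p 1 = q 0 -> 1 <= t ->
  join_path p q t = q (t - 1).
Proof.
by move=> pq; rewrite /join_path le_eqVlt => /orP[/eqP<-|t1];
  [rewrite lexx subrr | rewrite leNgt t1].
Qed.

End Join.

Lemma graph_ext (R : realType) (G1 G2 : graph R) :
  vertices G1 = vertices G2 ->
  (forall x y, adjacent G1 x y <-> adjacent G2 x y) -> G1 = G2.
Proof.
case: G1 G2 => V1 a1 s1 [V2 a2 s2] /= <- a12.
have E : a1 = a2 by apply/funext => x; apply/funext => y; apply/propext.
by case: _ / E s2 => s2; congr Graph; exact: Prop_irrelevance.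
Qed.

(** * Homotopy equivalences fixing vertices *)

Section GraphEquivalence.
Variable R : realType.
Implicit Types (G : graph R) (A : set R).

(* Unlike [graph_equivalent], this relation composes: requiring the first map
   to send vertices to vertices makes the finiteness of fibres transitive. *)
Definition vertex_equivalent A G1 G2 : Prop :=
  exists (f : realization G1 -> realization G2)
         (g : realization G2 -> realization G1)
         (phi : vertices G1 -> vertices G2) (iota : vertices G2 -> vertices G1),
    [/\ [/\ continuous f, continuous g, homot R (g \o f) id & homot R (f \o g) id],
        (forall v, f (Vertex v) = Vertex (phi v)) /\
        (forall w, g (Vertex w) = Vertex (iota w)),
        forall w, val (iota w) = val w,
        forall v, A (val v) -> val (phi v) = val v
      & forall w, finite_set [set v | phi v = w]].

Lemma vertex_equivalentW A G1 G2 :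
  vertex_equivalent A G1 G2 -> graph_equivalent A G1 G2.
Proof.
move=> [f [g [phi [iota [[cf cg gf fg] [fV gV] iotaE phiE fin]]]]].
exists f, g; split; first by split => //; exact: homot_homotopic.
- split=> v Av; first by exists (phi v); rewrite ?phiE.
  by exists (iota v); rewrite ?iotaE.
- split=> w; first by apply: sub_finite_set (fin w) => v /=; rewrite fV => -[].
  (* [iota] keeps the underlying real, so a vertex fibre of [g] has at most one element. *)
  apply: (@sub_finite_set _ _ [set v | val v = val w]) => [v|].
    by rewrite /= gV => -[<-]; rewrite iotaE.
  have [[v0 v0w]|no] := pselect (exists v : vertices G2, val v = val w).
    apply: (@sub_finite_set _ _ [set v0]) => //= v /= vw.
    by apply: val_inj; apply: etrans (esym v0w).
  by apply: (@sub_finite_set _ _ set0) => //= v vw; apply: no; exists v.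
Qed.

Lemma vertex_equivalent_refl A G : vertex_equivalent A G G.
Proof.
exists id, id, id, id; split => // [|w].
  by split; try (by move=> x; exact: cvg_id); apply: homot_refl => x; exact: cvg_id.
by apply: (@sub_finite_set _ _ [set w]).
Qed.

Lemma vertex_equivalent_trans A B G1 G2 G3 : B `<=` A ->
  vertex_equivalent A G1 G2 -> vertex_equivalent B G2 G3 ->
  vertex_equivalent B G1 G3.
Proof.
move=> BA [f [g [phi [iota [[cf cg gf fg] [fV gV] iotaE phiE fin]]]]].
move=> [f' [g' [phi' [iota' [[cf' cg' gf' fg'] [fV' gV'] iotaE' phiE' fin']]]]].
exists (f' \o f), (g \o g'), (phi' \o phi), (iota \o iota'); split.
- split.
  + by move=> x; apply: continuous_comp; [exact: cf|exact: cf'].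
  + by move=> x; apply: continuous_comp; [exact: cg'|exact: cg].
  + apply: homot_trans gf.
    exact: (homot_compl (h := g) cg (homot_compr (h := f) cf gf')).
  + apply: homot_trans fg'.
    exact: (homot_compl (h := f') cf' (homot_compr (h := g') cg' fg)).
- by split=> v /=; rewrite ?fV ?fV' ?gV' ?gV.
- by move=> w /=; rewrite iotaE iotaE'.
- by move=> v Bv /=; rewrite phiE' ?phiE //; exact: BA.
- move=> w.
  have -> : [set v | (phi' \o phi) v = w] =
            \bigcup_(u in [set u | phi' u = w]) [set v | phi v = u].
    apply/seteqP; split => [v /= <-|v [u /= <- <-]] //.
    by exists (phi v).
  by apply: bigcup_finite => [|u _]; [exact: fin'|exact: fin].
Qed.

End GraphEquivalence.

(** * Sliding edges along other edges *)

Section Slide.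
Variable R : realType.

(* [D x y z] says that sliding the end [y] along the common edge from [y] to [z]
   turns the edge [x y] of the first graph into the edge [x z] of the second. *)
Record slide (V : set R) (a1 a2 C : R -> R -> Prop) (D : R -> R -> R -> Prop) := {
  slide_sym : forall x y, C x y -> C y x;
  slide_neq : forall x y, C x y -> x <> y;
  slide_adj1 : forall x y, V x -> V y ->
    a1 x y <-> C x y \/ exists z, D x y z \/ D y x z;
  slide_adj2 : forall x z, V x -> V z ->
    a2 x z <-> C x z \/ exists y, D x y z \/ D z y x;
  slide_new : forall x y z, D x y z -> [/\ x <> y, x <> z, C z y, ~ C x y & ~ C x z];
  slide_V1 : forall x y z, D x y z -> V x -> V y -> V z;
  slide_V2 : forall x y z, D x y z -> V x -> V z -> V y;
  slide_fun1 : forall x y z z', D x y z -> D x y z' -> z = z';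
  slide_fun2 : forall x y y' z, D x y z -> D x y' z -> y = y';
  slide_or1 : forall x y z z', D x y z -> ~ D y x z';
  slide_or2 : forall x y y' z, D x y z -> ~ D z y' x
}.

(** Sliding back from [z] to [y] is again a slide, so the inverse map and the second homotopy come
    from the same lemmas as the first ones. *)
Lemma slide_swap V a1 a2 C D :
  slide V a1 a2 C D -> slide V a2 a1 C (fun x z y => D x y z).
Proof.
case=> Cs Cn A1 A2 new V1 V2 f1 f2 o1 o2.
by split => //= x y z; [case/new => *; split => //; exact: Cs|exact: V2|exact: V1
  |move=> z'; exact: f2|move=> z'; exact: f1|move=> z'; exact: o2|move=> z'; exact: o1].
Qed.

Section SlideMap.
Variables (V : set R) (a1 a2 C : R -> R -> Prop) (D : R -> R -> R -> Prop).
Variables (s1 : forall x y, a1 x y -> a1 y x) (s2 : forall x y, a2 x y -> a2 y x).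
Hypothesis sl : slide V a1 a2 C D.
Let G1 := Graph V s1.
Let G2 := Graph V s2.

Lemma slide_C1 (u v : V) : C (val u) (val v) -> val u <> val v /\ a1 (val u) (val v).
Proof.
move=> Cuv; split; first exact: (slide_neq sl Cuv).
by apply/(slide_adj1 sl); [exact: set_mem (valP u)|exact: set_mem (valP v)|left].
Qed.

Lemma slide_C2 (u v : V) : C (val u) (val v) -> val u <> val v /\ a2 (val u) (val v).
Proof.
move=> Cuv; split; first exact: (slide_neq sl Cuv).
by apply/(slide_adj2 sl); [exact: set_mem (valP u)|exact: set_mem (valP v)|left].
Qed.

Lemma slide_D (u v w : V) : D (val u) (val v) (val w) ->
  [/\ val u <> val v, val u <> val w, val w <> val v &
  [/\ a1 (val u) (val v), a2 (val u) (val w),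
      C (val w) (val v), C (val v) (val w) & ~ C (val u) (val v)]].
Proof.
have Vv (x : V) : V (val x) by exact: set_mem (valP x).
move=> Duvw; have [n1 n2 Cwv n3 n4] := slide_new sl Duvw.
have n5 := slide_neq sl Cwv.
split => //; split => //; last exact: (slide_sym sl Cwv).
  by apply/(slide_adj1 sl) => //; right; exists (val w); left.
by apply/(slide_adj2 sl) => //; right; exists (val v); left.
Qed.

Lemma slide_path (u v w : V) : D (val u) (val v) (val w) ->
  [/\ continuous (join_path (@seg R G2 u w) (@seg R G2 w v)),
      join_path (@seg R G2 u w) (@seg R G2 w v) 0 = @Vertex R G2 u,
      join_path (@seg R G2 u w) (@seg R G2 w v) 2 = @Vertex R G2 v
    & @seg R G2 u w 1 = @seg R G2 w v 0].
Proof.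
move=> /slide_D[_ uw wv [_ auw /slide_C2[_ awv] _ _]].
have E : @seg R G2 u w 1 = @seg R G2 w v 0 by rewrite seg_ge1 // seg_le0.
split => //.
- by apply: join_path_continuous => //; exact: seg_continuous.
- by rewrite /join_path ler01 seg_le0.
- rewrite (join_path_ge1 E); last lra.
  by rewrite seg_ge1 //; lra.
Qed.

(** A kept edge goes to itself and a moved edge [u v] to the path [u w v] in the second graph. The
    fields on uniqueness and orientation in [slide] make this choice unambiguous for each stored
    edge. *)
Lemma slide_map : exists f : realization G1 -> realization G2,
  [/\ continuous f, forall v : V, f (@Vertex R G1 v) = @Vertex R G2 v,
      forall (u v : V) t, 0 <= t <= 1 -> C (val u) (val v) ->
        f (@seg R G1 u v t) = @seg R G2 u v t
    & forall (u v w : V) t, 0 <= t <= 1 -> D (val u) (val v) (val w) ->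
        f (@seg R G1 u v t) =
        join_path (@seg R G2 u w) (@seg R G2 w v) (2 * t)].
Proof.
have Vv (x : V) : V (val x) by exact: set_mem (valP x).
have /choice[fe feP] : forall e : edges G1, exists fe : R -> realization G2,
    let u : V := edge_src e in let v : V := edge_tgt e in
    [/\ continuous fe, fe 0 = @Vertex R G2 u, fe 1 = @Vertex R G2 v &
    [/\ C (val u) (val v) -> fe = @seg R G2 u v,
        forall w : V, D (val u) (val v) (val w) ->
          forall t, fe t = join_path (@seg R G2 u w) (@seg R G2 w v) (2 * t)
      & forall w : V, D (val v) (val u) (val w) ->
          forall t, fe t = join_path (@seg R G2 v w) (@seg R G2 w u) (2 * (1 - t))]].
  move=> e; set u : V := edge_src e; set v : V := edge_tgt e.
  have : a1 (val u) (val v) by case: (set_mem (valP e)).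
  move=> /(slide_adj1 sl (Vv u) (Vv v))[Cuv|[z [Duv|Dvu]]].
  - have [uv auv] := slide_C2 Cuv.
    exists (@seg R G2 u v); split.
    + exact: seg_continuous.
    + by rewrite seg_le0.
    + by rewrite seg_ge1.
    + by split => // w /slide_D[_ _ _ [_ _ _ _]] // /(_ (slide_sym sl Cuv)).
  - have zV := slide_V1 sl Duv (Vv u) (Vv v).
    pose w : V := exist _ z (mem_set zV).
    have Dw : D (val u) (val v) (val w) by [].
    have [cw w0 w1 _] := slide_path Dw.
    exists (fun t => join_path (@seg R G2 u w) (@seg R G2 w v) (2 * t + 0)); split.
    + move=> t; apply: (@continuous_comp R R (realization G2) (fun t : R => 2 * t + 0)
        (join_path (@seg R G2 u w) (@seg R G2 w v))); last exact: cw.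
      exact: scale_add_continuous.
    + by rewrite mulr0 addr0.
    + by rewrite mulr1 addr0.
    + split => [Cuv|w' Dw' t|w' Dw'].
      * by have [_ _ _ [_ _ _ _]] := slide_D Dw.
      * have -> : w' = w by apply: val_inj; exact: (slide_fun1 sl Dw' Dw).
        by rewrite addr0.
      * by have := slide_or1 sl Dw Dw'.
  - have zV := slide_V1 sl Dvu (Vv v) (Vv u).
    pose w : V := exist _ z (mem_set zV).
    have Dw : D (val v) (val u) (val w) by [].
    have [cw w0 w1 _] := slide_path Dw.
    exists (fun t => join_path (@seg R G2 v w) (@seg R G2 w u) (-2 * t + 2)); split.
    + move=> t; apply: (@continuous_comp R R (realization G2) (fun t : R => -2 * t + 2)
        (join_path (@seg R G2 v w) (@seg R G2 w u))); last exact: cw.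
      exact: scale_add_continuous.
    + by rewrite mulr0 add0r.
    + by rewrite mulr1 addNr.
    + split => [Cuv|w' Dw'|w' Dw' t].
      * by have [_ _ _ [_ _ _ _ []]] := slide_D Dw; exact: (slide_sym sl Cuv).
      * by have := slide_or1 sl Dw Dw'.
      * have -> : w' = w by apply: val_inj; exact: (slide_fun1 sl Dw' Dw).
        by congr join_path; lra.
have [f [cf fV fC]] := @map_of_cells R G1 _ (fun v : V => @Vertex R G2 v) fe
  (fun e => let: And4 c _ _ _ := feP e in c)
  (fun e => let: And4 _ c _ _ := feP e in c)
  (fun e => let: And4 _ _ c _ := feP e in c).
exists f; split => // [u v t t01 Cuv|u v w t t01 Dw].
- have [uv auv] := slide_C1 Cuv.
  have [uv' auv'] := slide_C2 Cuv.
  have [e [[eu ev -> _]|[ev eu -> _]]] := @segP R G1 u v uv auv; (rewrite fC; last lra).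
    by have [_ _ _ []] := feP e; rewrite eu ev => ->.
  have [_ _ _ [+ _ _]] := feP e; rewrite eu ev => /(_ (slide_sym sl Cuv)) ->.
  by rewrite (@seg_rev R G2 u v) //; congr seg; lra.
- have [uv _ _ [auv _ _ _ _]] := slide_D Dw.
  have [e [[eu ev -> _]|[ev eu -> _]]] := @segP R G1 u v uv auv; (rewrite fC; last lra).
    by have [_ _ _ [_ + _]] := feP e; rewrite eu ev => /(_ _ Dw) ->.
  have [_ _ _ [_ _ +]] := feP e; rewrite eu ev => /(_ _ Dw) ->.
  by congr join_path; lra.
Qed.

End SlideMap.

(* Both maps unfold to paths over the line [u v w]: the composite runs along it
   from [u] to [w] and back to [v], which is deformed linearly into [u v]. *)
Lemma slide_homot V a1 a2 C D (s1 : forall x y, a1 x y -> a1 y x)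
    (s2 : forall x y, a2 x y -> a2 y x)
    (f : realization (Graph V s1) -> realization (Graph V s2))
    (g : realization (Graph V s2) -> realization (Graph V s1)) :
  slide V a1 a2 C D ->
  (forall v : V, f (@Vertex R (Graph V s1) v) = @Vertex R (Graph V s2) v) ->
  (forall v : V, g (@Vertex R (Graph V s2) v) = @Vertex R (Graph V s1) v) ->
  (forall (u v : V) t, 0 <= t <= 1 -> C (val u) (val v) ->
     f (@seg R (Graph V s1) u v t) = @seg R (Graph V s2) u v t) ->
  (forall (u v : V) t, 0 <= t <= 1 -> C (val u) (val v) ->
     g (@seg R (Graph V s2) u v t) = @seg R (Graph V s1) u v t) ->
  (forall (u v w : V) t, 0 <= t <= 1 -> D (val u) (val v) (val w) ->
     f (@seg R (Graph V s1) u v t) =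
     join_path (@seg R (Graph V s2) u w) (@seg R (Graph V s2) w v) (2 * t)) ->
  (forall (u v w : V) t, 0 <= t <= 1 -> D (val u) (val v) (val w) ->
     g (@seg R (Graph V s2) u w t) =
     join_path (@seg R (Graph V s1) u v) (@seg R (Graph V s1) v w) (2 * t)) ->
  homot R (g \o f) id.
Proof.
set G1 := Graph V s1; set G2 := Graph V s2.
move=> sl fV gV fC gC fD gD.
have Vv (x : V) : V (val x) by exact: set_mem (valP x).
(* Position of the composite on the line [u v w] parametrized by [0, 2]: the half of the path over
   [u w] is itself stretched to [u v w], hence slope 4 up to 2, and the half over [w v] returns with
   slope -2 to 1. *)
pose alpha (t : R) := if t <= 1 / 2 then 4 * t + 0 else -2 * t + 3.
have calpha : continuous alpha.
  apply: (@continuous_if_le R) => [t|t|t|t ->]; [exact: cvg_id| | |by lra];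
  exact: scale_add_continuous.
have key (u v w : V) : D (val u) (val v) (val w) ->
    let Q := join_path (@seg R G1 u v) (@seg R G1 v w) in
    [/\ continuous Q, forall t, 0 <= t <= 1 -> g (f (@seg R G1 u v t)) = Q (alpha t)
      & forall t, t <= 1 -> @seg R G1 u v t = Q t].
  move=> Dw; have [uv uw wv [auv auw Cwv Cvw _]] := slide_D sl Dw.
  have [_ awv2] := slide_C2 sl Cwv.
  have [vw avw1] := slide_C1 sl Cvw.
  have E : @seg R G1 u v 1 = @seg R G1 v w 0 by rewrite seg_ge1 // seg_le0.
  split => [|t t01|t t1].
  - by apply: join_path_continuous => //; exact: seg_continuous.
  - rewrite (fD _ _ w) // /alpha; case: (leP t (1 / 2)) => th.
      rewrite /join_path ifT; last lra.
      rewrite (gD _ v) //; last lra.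
      by rewrite /join_path addr0 mulrA -natrM.
    rewrite join_path_ge1; [|by rewrite seg_ge1 // seg_le0|lra].
    rewrite gC //; last lra.
    rewrite join_path_ge1 //; last lra.
    rewrite (@seg_rev R G1 v w) //; congr seg; lra.
  - by rewrite /join_path t1.
apply: (@homot_of_cells R G1 _ _ _ (fun v _ => @Vertex R G1 v)) => //=.
- by move=> v t; exact: cvg_cst.
- by move=> v; rewrite fV gV.
move=> e; set u : V := edge_src e; set v : V := edge_tgt e.
have eE t : cell e t = @seg R G1 u v t by exact: cell_seg.
have : a1 (val u) (val v) by case: (set_mem (valP e)).
have cline (b c : R -> R) : continuous b -> continuous c ->
    continuous (fun p : R * R => (1 - p.2) * b p.1 + p.2 * c p.1).
  move=> cb cc p; apply: cvgD; apply: cvgM.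
  + by apply: cvgB; [exact: cvg_cst|exact: cvg_snd].
  + by apply: (@continuous_comp _ _ _ fst b); [exact: cvg_fst|exact: cb].
  + exact: cvg_snd.
  + by apply: (@continuous_comp _ _ _ fst c); [exact: cvg_fst|exact: cc].
have alpha0 : alpha 0 = 0 by rewrite /alpha ifT; lra.
have alpha1 : alpha 1 = 1.
  by rewrite /alpha ifF; [lra|apply/negbTE; rewrite -ltNge; lra].
move=> /(slide_adj1 sl (Vv u) (Vv v))[Cuv|[z [Duv|Dvu]]].
- have [uv auv] := slide_C1 sl Cuv.
  exists (fun p => cell e p.1); split => [p|s|t t01] /=.
  + by apply: (@continuous_comp _ _ _ fst (cell e)); [exact: cvg_fst|exact: cell_continuous].
  + by rewrite cell_le0 // cell_ge1.
  + by rewrite eE fC // gC.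
- have zV := slide_V1 sl Duv (Vv u) (Vv v).
  pose w : V := exist _ z (mem_set zV).
  have Dw : D (val u) (val v) (val w) by [].
  have [uv _ _ [auv _ _ _ _]] := slide_D sl Dw.
  have [cQ gfQ idQ] := key _ _ _ Dw.
  (* Linear interpolation between [alpha] and the identity; both fix 0 and 1, so vertices do not
     move. *)
  exists (fun p => join_path (@seg R G1 u v) (@seg R G1 v w)
                     ((1 - p.2) * alpha p.1 + p.2 * p.1)); split => [p|s|t t01] /=.
  + apply: (@continuous_comp _ _ _ (fun p : R * R => (1 - p.2) * alpha p.1 + p.2 * p.1)
      (join_path (@seg R G1 u v) (@seg R G1 v w)));
      last exact: cQ.
    by apply: (cline alpha id) => // t; exact: cvg_id.
  + rewrite alpha0 alpha1 !mulr0 !mulr1 addr0 subrK -!idQ //.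
    by rewrite seg_le0 // seg_ge1.
  + rewrite eE gfQ // idQ; last lra.
    by split; [rewrite subr0 mul1r mul0r addr0|rewrite subrr mul1r mul0r add0r].
- have zV := slide_V1 sl Dvu (Vv v) (Vv u).
  pose w : V := exist _ z (mem_set zV).
  have Dw : D (val v) (val u) (val w) by [].
  have [vu _ _ [avu _ _ _ _]] := slide_D sl Dw.
  have [cQ gfQ idQ] := key _ _ _ Dw.
  have eE' t : cell e t = @seg R G1 v u (1 - t) by rewrite eE (@seg_rev R G1 v u).
  exists (fun p => join_path (@seg R G1 v u) (@seg R G1 u w)
                     ((1 - p.2) * alpha (1 - p.1) + p.2 * (1 - p.1))); split => [p|s|t t01] /=.
  + apply: (@continuous_comp _ _ _
      (fun p : R * R => (1 - p.2) * alpha (1 - p.1) + p.2 * (1 - p.1))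
      (join_path (@seg R G1 v u) (@seg R G1 u w))); last exact: cQ.
    apply: (cline (fun t => alpha (1 - t)) (fun t => 1 - t)); last exact: one_sub_continuous.
    move=> t; apply: (@continuous_comp R R R (fun t : R => 1 - t) alpha); last exact: calpha.
    exact: one_sub_continuous.
  + rewrite subr0 subrr alpha0 alpha1 !mulr0 !mulr1 addr0 subrK -!idQ //.
    by rewrite seg_ge1 // seg_le0.
  + rewrite eE' gfQ; last lra.
    rewrite idQ; last lra.
    by split; [rewrite subr0 mul1r mul0r addr0|rewrite subrr mul1r mul0r add0r].
Qed.

Lemma slide_equivalent (A : set R) V a1 a2 C D (s1 : forall x y, a1 x y -> a1 y x)
    (s2 : forall x y, a2 x y -> a2 y x) :
  slide V a1 a2 C D -> vertex_equivalent A (Graph V s1) (Graph V s2).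
Proof.
move=> sl; have sl' := slide_swap sl.
have [f [cf fV fC fD]] := slide_map s1 s2 sl.
have [g [cg gV gC gD]] := slide_map s2 s1 sl'.
exists f, g, id, id; split => // [|w].
  split => //; first exact: (slide_homot sl fV gV fC gC fD (fun u v w => gD u w v)).
  exact: (slide_homot sl' gV fV gC fC gD (fun u v w => fD u w v)).
by apply: (@sub_finite_set _ _ [set w]).
Qed.

End Slide.

(** * Collapsing leaves *)

Section Collapse.
Variable R : realType.

(** Every vertex outside [G2] is a leaf hanging on its foot [parent x] in [G2]. The fibre condition
    bounds the leaves on one foot, as finiteness of vertex preimages demands. *)
Record collapse (G1 G2 : graph R) (parent : R -> R) := {
  collapse_sub : vertices G2 `<=` vertices G1;
  collapse_adj : forall x y, vertices G2 x -> vertices G2 y ->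
    adjacent G1 x y <-> adjacent G2 x y;
  collapse_neq : forall x y, vertices G1 x -> vertices G1 y ->
    adjacent G1 x y -> x <> y;
  collapse_parent : forall x, vertices G1 x -> ~ vertices G2 x ->
    vertices G2 (parent x) /\ adjacent G1 x (parent x);
  collapse_leaf : forall x y, vertices G1 x -> ~ vertices G2 x ->
    vertices G1 y -> adjacent G1 x y -> y = parent x;
  collapse_fiber : forall w, finite_set [set x | parent x = w]
}.

(** [f] sends a leaf together with its edge to the foot and [g] is the inclusion. Then [f \o g] is
    the identity on the nose, and only [g \o f] needs a homotopy, in which the leaf edges grow
    back. *)
Lemma collapse_equivalent A G1 G2 parent : collapse G1 G2 parent ->
  (forall x, vertices G1 x -> A x -> vertices G2 x) ->
  vertex_equivalent A G1 G2.
Proof.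
move=> col A12.
have V1 (v : vertices G1) : vertices G1 (val v) by exact: set_mem (valP v).
have V2 (v : vertices G2) : vertices G2 (val v) by exact: set_mem (valP v).
pose rho x := if `[< vertices G2 x >] then x else parent x.
have rho_id x : vertices G2 x -> rho x = x by rewrite /rho; case: asboolP.
have rho_par x : ~ vertices G2 x -> rho x = parent x by rewrite /rho; case: asboolP.
have rhoV x : vertices G1 x -> vertices G2 (rho x).
  by rewrite /rho => Vx; case: asboolP => // /(collapse_parent col Vx)[].
pose phi (v : vertices G1) : vertices G2 := exist _ (rho (val v)) (mem_set (rhoV _ (V1 v))).
pose iota (v : vertices G2) : vertices G1 :=
  exist _ (val v) (mem_set (collapse_sub col (V2 v))).
have phiE v : val (phi v) = rho (val v) by [].
have iotaE v : val (iota v) = val v by [].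
have phiK v : phi (iota v) = v by apply: val_inj; rewrite phiE iotaE rho_id.
have adj2 (u v : vertices G1) : adjacent G1 (val u) (val v) ->
    vertices G2 (val u) -> vertices G2 (val v) ->
    adjacent G2 (val (phi u)) (val (phi v)).
  by move=> auv Vu Vv; rewrite !phiE !rho_id //; apply/(collapse_adj col).
have neq1 (u v : vertices G1) : adjacent G1 (val u) (val v) -> val u <> val v.
  exact: (collapse_neq col (V1 u) (V1 v)).
have neq2 (u v : vertices G2) : adjacent G2 (val u) (val v) -> val u <> val v.
  by move=> /(collapse_adj col (V2 u) (V2 v)) /(neq1 (iota u) (iota v)).
have eadj1 (e : edges G1) : adjacent G1 (val (edge_src e)) (val (edge_tgt e)).
  by case: (set_mem (valP e)).
have eadj2 (e : edges G2) : adjacent G2 (val (edge_src e)) (val (edge_tgt e)).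
  by case: (set_mem (valP e)).
have leafE (u v : vertices G1) : adjacent G1 (val u) (val v) ->
    ~ vertices G2 (val u) -> v = iota (phi u).
  move=> auv nu; apply: val_inj; rewrite iotaE phiE rho_par //.
  exact: (collapse_leaf col _ nu).
have leaf_phi (u v : vertices G1) : adjacent G1 (val u) (val v) ->
    ~ vertices G2 (val u) -> phi u = phi v.
  by move=> auv nu; rewrite (leafE _ _ auv nu) phiK.
have /choice[fe feP] : forall e : edges G1, exists fe : R -> realization G2,
    let u := edge_src e in let v := edge_tgt e in
    [/\ continuous fe, fe 0 = Vertex (phi u), fe 1 = Vertex (phi v) &
    [/\ vertices G2 (val u) -> vertices G2 (val v) -> fe = seg (phi u) (phi v),
        ~ vertices G2 (val u) -> fe = fun=> Vertex (phi u)
      & ~ vertices G2 (val v) -> fe = fun=> Vertex (phi v)]].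
  move=> e; set u := edge_src e; set v := edge_tgt e.
  have auv : adjacent G1 (val u) (val v) by exact: eadj1.
  have [Vu|nu] := pselect (vertices G2 (val u)); last first.
    exists (fun=> Vertex (phi u)); split; first by move=> t; exact: cvg_cst.
    + by [].
    + by rewrite (leaf_phi _ _ auv nu).
    + by split => // _; rewrite (leaf_phi _ _ auv nu).
  have [Vv|nv] := pselect (vertices G2 (val v)); last first.
    have avu : adjacent G1 (val v) (val u) by exact: adjacent_sym.
    exists (fun=> Vertex (phi v)); split; first by move=> t; exact: cvg_cst.
    + by rewrite (leaf_phi _ _ avu nv).
    + by [].
    + by split.
  have auv2 := adj2 _ _ auv Vu Vv; have neq := neq2 _ _ auv2.
  exists (seg (phi u) (phi v)); split => //; first exact: seg_continuous.
  + by rewrite seg_le0.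
  + by rewrite seg_ge1.
have [f [cf fV fC]] := @map_of_cells R G1 _ (fun v => Vertex (phi v)) fe
  (fun e => let: And4 c _ _ _ := feP e in c)
  (fun e => let: And4 _ c _ _ := feP e in c)
  (fun e => let: And4 _ _ c _ := feP e in c).
have eadj21 (e : edges G2) : adjacent G1 (val (iota (edge_src e))) (val (iota (edge_tgt e))).
  by rewrite !iotaE; apply/(collapse_adj col) => //; exact: eadj2.
have ge0 (e : edges G2) : seg (iota (edge_src e)) (iota (edge_tgt e)) 0 = Vertex (iota (edge_src e)).
  by rewrite seg_le0 //; apply: neq1.
have ge1 (e : edges G2) : seg (iota (edge_src e)) (iota (edge_tgt e)) 1 = Vertex (iota (edge_tgt e)).
  by rewrite seg_ge1 //; apply: neq1.
have [g [cg gV gC]] := @map_of_cells R G2 _ (fun v => Vertex (iota v)) _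
  (fun e => @seg_continuous R G1 _ _) ge0 ge1.
have fgE (e : edges G2) t : 0 <= t <= 1 -> f (g (cell e t)) = cell e t.
  move=> t01; rewrite gC // cell_seg.
  set u := edge_src e; set v := edge_tgt e.
  have auv : adjacent G2 (val u) (val v) by exact: eadj2.
  have [e' [[eu ev -> _]|[ev eu -> _]]] := segP (neq1 _ _ (eadj21 e)) (eadj21 e);
    (rewrite fC; last lra).
  - have [_ _ _ [+ _ _]] := feP e'; rewrite eu ev !iotaE => -> //; rewrite ?phiK //; exact: V2.
  - have [_ _ _ [+ _ _]] := feP e'; rewrite eu ev !iotaE => ->; rewrite ?phiK;
      [|exact: V2|exact: V2].
    by rewrite (seg_rev (neq2 _ _ auv) auv); congr seg; lra.
exists f, g, phi, iota; split => //.
- split => //; last first.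
    have -> : f \o g = id.
      apply/funext => -[v|e s] /=; first by rewrite gV fV phiK.
      by rewrite -cell_inner fgE //; have := inner_bounds s; lra.
    by apply: homot_refl => x; exact: cvg_id.
  (* Tracks of vertices: a leaf starts at its foot and runs out along its edge, the other vertices
     stay. *)
  pose hv (v : vertices G1) (s : R) :=
    if `[< vertices G2 (val v) >] then Vertex v else seg (iota (phi v)) v s.
  have hv_id v s : vertices G2 (val v) -> hv v s = Vertex v by rewrite /hv; case: asboolP.
  have hv_par v s : ~ vertices G2 (val v) -> hv v s = seg (iota (phi v)) v s.
    by rewrite /hv; case: asboolP.
  have padj (v : vertices G1) : ~ vertices G2 (val v) ->
      adjacent G1 (val (iota (phi v))) (val v).
    move=> nv; apply: adjacent_sym; rewrite iotaE phiE rho_par //.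
    by have [] := collapse_parent col (V1 v) nv.
  have phi_id v : vertices G2 (val v) -> iota (phi v) = v.
    by move=> Vv; apply: val_inj; rewrite iotaE phiE rho_id.
  apply: (@homot_of_cells R G1 _ _ _ hv) => [v|v|v|e].
  + rewrite /hv; case: asboolP => _ t; first exact: cvg_cst.
    exact: seg_continuous.
  + rewrite /= fV gV; have [Vv|nv] := pselect (vertices G2 (val v)).
      by rewrite hv_id // phi_id.
    by rewrite hv_par // seg_le0 //; [exact: neq1 (padj _ nv)|exact: padj].
  + have [Vv|nv] := pselect (vertices G2 (val v)); first by rewrite hv_id.
    by rewrite hv_par // seg_ge1 //; [exact: neq1 (padj _ nv)|exact: padj].
  + have auv := eadj1 e; set u := edge_src e in auv *; set v := edge_tgt e in auv *.
    have neq := neq1 _ _ auv.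
    have avu : adjacent G1 (val v) (val u) by exact: adjacent_sym.
    have eE t : cell e t = seg u v t by exact: cell_seg.
    have [Vu|nu] := pselect (vertices G2 (val u)); last first.
      have Vv : vertices G2 (val v) by rewrite (leafE _ _ auv nu) iotaE; exact: V2.
      have v0 : seg v u 0 = Vertex v by rewrite seg_le0 //; exact: nesym neq.
      (* Here [u] is the leaf and [1 - t] is the parameter measured from the foot [v]; multiplying
         it by the time gives the foot at time 0 and the edge at time 1. *)
      exists (fun p => seg v u (p.2 * (1 - p.1))); split => [p|s|t t01] /=.
      * apply: (@continuous_comp (R * R)%type R (realization G1)
          (fun p : R * R => p.2 * (1 - p.1)) (seg v u)); last exact: seg_continuous.
        apply: cvgM; first exact: cvg_snd.
        by apply: cvgB; [exact: cvg_cst|exact: cvg_fst].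
      * by rewrite subr0 subrr mulr1 mulr0 hv_par // -(leafE _ _ auv nu) hv_id //.
      * rewrite mul0r fC //; have [_ _ _ [_ -> // _]] := feP e.
        by rewrite gV -(leafE _ _ auv nu) eE v0 (seg_rev (nesym neq) avu) mul1r.
    have [Vv|nv] := pselect (vertices G2 (val v)); last first.
      have u0 : seg u v 0 = Vertex u by rewrite seg_le0.
      exists (fun p => seg u v (p.2 * p.1)); split => [p|s|t t01] /=.
      * apply: (@continuous_comp (R * R)%type R (realization G1)
          (fun p : R * R => p.2 * p.1) (seg u v)); last exact: seg_continuous.
        by apply: cvgM; [exact: cvg_snd|exact: cvg_fst].
      * by rewrite mulr0 mulr1 hv_id // hv_par // -(leafE _ _ avu nv) u0.
      * rewrite mul0r mul1r fC //; have [_ _ _ [_ _ -> //]] := feP e.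
        by rewrite gV -(leafE _ _ avu nv) eE u0.
    exists (fun p => cell e p.1); split => [p|s|t t01] /=.
    * by apply: (@continuous_comp _ _ _ fst (cell e)); [exact: cvg_fst|exact: cell_continuous].
    * by rewrite cell_le0 // cell_ge1 // !hv_id.
    * split => //; rewrite fC //; have [_ _ _ [-> // _ _]] := feP e.
      have auv2 := adj2 _ _ auv Vu Vv.
      have [e' [[eu ev -> _]|[ev eu -> _]]] := segP (neq2 _ _ auv2) auv2;
        (rewrite gC; last lra); rewrite eu ev !phi_id // eE.
      by rewrite (seg_rev neq auv); congr seg; lra.
- by move=> v Av; rewrite phiE rho_id //; exact: A12.
- move=> w; apply: (@sub_finite_set _ _ ((fun v : vertices G1 => val v) @^-1` (val w |` [set x | parent x = val w]))).
    move=> v /= <-; have [Vv|nv] := pselect (vertices G2 (val v)); [left|right] => /=.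
      by rewrite rho_id.
    by rewrite rho_par.
  apply: finite_preimage; first by move=> ? ? _ _; exact: val_inj.
  by rewrite finite_setU; split; [exact: finite_set1|exact: (collapse_fiber col)].
Qed.

End Collapse.

(** * Reductions of graphs and of systems of translations *)

Section Reduction.
Variable R : realType.
Implicit Types G : graph R.

Definition reach G := clos_refl_trans R
  (fun p q => [/\ vertices G p, vertices G q & adjacent G p q]).

Lemma reach_sym G x y : reach G x y -> reach G y x.
Proof.
elim=> [p q [Vp Vq pq]|p|p q r _ qp _ rq]; last exact: rt_trans rq qp.
  by apply: rt_step; split => //; exact: adjacent_sym.
exact: rt_refl.
Qed.

(** The graph form of equivalence with zero translation, the vertices of [G2] playing the part of
    [A, B]. Unlike [equivalent], it is set up to be chained. *)
Definition reduces G1 G2 : Prop :=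
  [/\ vertices G2 `<=` vertices G1,
      forall x, vertices G1 x -> exists2 y, vertices G2 y & reach G1 x y
    & forall x, vertices G2 x ->
        vertex_equivalent (vertices G2) (component G1 x) (component G2 x)].

Lemma reduces_refl G : reduces G G.
Proof.
split => // x Vx; last exact: vertex_equivalent_refl.
by exists x => //; exact: rt_refl.
Qed.

(** The vertex map [iota] back into [component G1 x] keeps the underlying real, so that component
    contains the one of [G2]. *)
Lemma reduces_reach G1 G2 x y : reduces G1 G2 ->
  vertices G2 x -> vertices G2 y -> reach G2 x y -> reach G1 x y.
Proof.
move=> [_ _ eqv] Vx Vy xy.
have [_ [_ [_ [iota [_ _ iotaE _ _]]]]] := eqv _ Vx.
have yin : y \in vertices (component G2 x) by apply/mem_set.
have /set_mem[_] := valP (iota (exist _ y yin)).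
by rewrite iotaE.
Qed.

Lemma reduces_trans G1 G2 G3 : reduces G1 G2 -> reduces G2 G3 -> reduces G1 G3.
Proof.
move=> r12; have [V21 o12 e12] := r12; move=> [V32 o23 e23]; split.
- by move=> x /V32 /V21.
- move=> x /o12[y Vy xy]; have [z Vz yz] := o23 _ Vy; exists z => //.
  by apply: rt_trans xy _; apply: reduces_reach r12 _ _ yz => //; exact: V32.
- move=> x Vx; have Vx2 := V32 _ Vx.
  exact: vertex_equivalent_trans V32 (e12 _ Vx2) (e23 _ Vx).
Qed.

Lemma slide_reach V a1 a2 C D (s1 : forall x y, a1 x y -> a1 y x)
    (s2 : forall x y, a2 x y -> a2 y x) (x y : R) :
  slide V a1 a2 C D -> reach (Graph V s1) x y -> reach (Graph V s2) x y.
Proof.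
move=> sl; elim=> [p q [/= Vp Vq]|p|p q r _ qp _ rq]; last exact: rt_trans qp rq.
  have D2 u v w : V u -> V v -> D u v w -> reach (Graph V s2) u v.
    move=> Vu Vv Duvw; have Vw := slide_V1 sl Duvw Vu Vv.
    have [_ _ Cwv _ _] := slide_new sl Duvw.
    apply: (@rt_trans _ _ _ w); apply: rt_step; split => //=.
      by apply/(slide_adj2 sl) => //; right; exists v; left.
    by apply/(slide_adj2 sl) => //; left.
  move=> /(slide_adj1 sl Vp Vq)[Cpq|[z [Dpq|Dqp]]].
  - by apply: rt_step; split => //=; apply/(slide_adj2 sl) => //; left.
  - exact: D2 Dpq.
  - by apply: reach_sym; exact: D2 Dqp.
exact: rt_refl.
Qed.

Lemma slide_reduces V a1 a2 C D (s1 : forall x y, a1 x y -> a1 y x)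
    (s2 : forall x y, a2 x y -> a2 y x) :
  slide V a1 a2 C D -> reduces (Graph V s1) (Graph V s2).
Proof.
move=> sl; split => //= [x Vx|x Vx]; first by exists x => //; exact: rt_refl.
have sl' := slide_swap sl.
(* Slides preserve connectedness, so both components have the vertex set [W], and the slide
   restricts to it. *)
pose W := V `&` [set y | reach (Graph V s1) x y].
have -> : component (Graph V s1) x = Graph W s1 by apply: graph_ext.
have -> : component (Graph V s2) x = Graph W s2.
  apply: graph_ext => //=; apply/seteqP; split => y /= [Vy xy]; split => //.
    exact: (slide_reach s1 sl' xy).
  exact: (slide_reach s2 sl xy).
apply: (@slide_equivalent R _ W a1 a2 C D).
have WV y : W y -> V y by case.
have W_step p q : W p -> V q -> a1 p q -> W q.
  move=> [Vp xp] Vq pq; split => //=.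
  by apply: rt_trans xp _; apply: rt_step.
have W_step2 p q : W p -> V q -> a2 p q -> W q.
  move=> [Vp xp] Vq pq; split => //=; apply: rt_trans xp _.
  have pq2 : reach (Graph V s2) p q by apply: rt_step.
  exact: (slide_reach s1 sl' pq2).
split => //.
- exact: slide_sym sl.
- exact: slide_neq sl.
- by move=> p q /WV Vp /WV Vq; exact: (slide_adj1 sl Vp Vq).
- by move=> p q /WV Vp /WV Vq; exact: (slide_adj2 sl Vp Vq).
- exact: slide_new sl.
- move=> p q r Dpq Wp Wq.
  have Vr := slide_V1 sl Dpq (WV _ Wp) (WV _ Wq).
  apply: (W_step2 p) => //; apply/(slide_adj2 sl) => //; first exact: WV.
  by right; exists q; left.
- move=> p q r Dpq Wp Wr.
  have Vq := slide_V2 sl Dpq (WV _ Wp) (WV _ Wr).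
  apply: (W_step p) => //; apply/(slide_adj1 sl) => //; first exact: WV.
  by right; exists r; left.
- exact: slide_fun1 sl.
- exact: slide_fun2 sl.
- exact: slide_or1 sl.
- exact: slide_or2 sl.
Qed.

(** Replacing each leaf by its foot turns a path of [G1] into a path of [G2], the leaf edges
    becoming constant. *)
Lemma collapse_reach G1 G2 parent x y : collapse G1 G2 parent ->
  vertices G2 x -> vertices G2 y -> reach G1 x y <-> reach G2 x y.
Proof.
move=> col Vx Vy; split; last first.
  elim=> [p q [Vp Vq pq]|p|p q r _ qp _ rq]; [|exact: rt_refl|exact: rt_trans qp rq].
  apply: rt_step; split; [exact: (collapse_sub col Vp)|exact: (collapse_sub col Vq)|].
  by apply/(collapse_adj col).
pose rho x := if `[< vertices G2 x >] then x else parent x.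
have rho_id z : vertices G2 z -> rho z = z by rewrite /rho; case: asboolP.
have rho_par z : ~ vertices G2 z -> rho z = parent z by rewrite /rho; case: asboolP.
rewrite -{2}(rho_id _ Vx) -{2}(rho_id _ Vy).
elim=> [p q [Vp Vq pq]|p|p q r _ qp _ rq]; [|exact: rt_refl|exact: rt_trans qp rq].
have [Wp|np] := pselect (vertices G2 p); last first.
  have qE := collapse_leaf col Vp np Vq pq.
  have [Wq _] := collapse_parent col Vp np.
  by rewrite (rho_par p) // rho_id qE //; exact: rt_refl.
have [Wq|nq] := pselect (vertices G2 q); last first.
  have pE := collapse_leaf col Vq nq Vp (adjacent_sym pq).
  have [Wq _] := collapse_parent col Vq nq.
  by rewrite (rho_par q) // rho_id pE //; exact: rt_refl.
by rewrite !rho_id //; apply: rt_step; split => //; apply/(collapse_adj col).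
Qed.

Lemma collapse_reduces G1 G2 parent : collapse G1 G2 parent -> reduces G1 G2.
Proof.
move=> col; have V21 := collapse_sub col; split => // [x Vx|x Vx].
  have [Wx|nx] := pselect (vertices G2 x); first by exists x => //; exact: rt_refl.
  have [Wp xp] := collapse_parent col Vx nx.
  by exists (parent x) => //; apply: rt_step; split => //; exact: V21.
apply: (@collapse_equivalent R _ _ _ parent); last first.
  by move=> y [Vy xy] Wy; split => //; apply/(collapse_reach col).
split => /=.
- by move=> y [Wy xy]; split; [exact: V21|apply/(collapse_reach col)].
- by move=> y z [Vy _] [Vz _]; exact: (collapse_adj col Vy Vz).
- by move=> y z [Vy _] [Vz _]; exact: (collapse_neq col Vy Vz).
- move=> y [Vy xy] ny.
  have nWy : ~ vertices G2 y.
    by move=> Wy; apply: ny; split => //; apply/(collapse_reach col).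
  have [Wp yp] := collapse_parent col Vy nWy; split => //; split => //.
  apply/(collapse_reach col) => //; apply: rt_trans xy _.
  by apply: rt_step; split => //; exact: V21.
- move=> y z [Vy xy] ny [Vz _]; apply: (collapse_leaf col) => // Wy.
  by apply: ny; split => //; apply/(collapse_reach col).
- exact: collapse_fiber col.
Qed.

End Reduction.

(** * Graphs of three partial translations of an interval *)

Section TranslationGraphs.
Variable R : realType.

(** The triple [(p, l, t)] stands for [p, p + l] <-> [p + t, p + l + t], with [t] of any sign. In
    this encoding a slide changes only a [t] and a cut only an [l]. *)
Definition trans_edge (T : R * R * R) (x y : R) : Prop :=
  let: (p, l, t) := T in
  (p <= x <= p + l /\ y = x + t) \/ (p <= y <= p + l /\ x = y + t).

Lemma trans_edge_sym T x y : trans_edge T x y -> trans_edge T y x.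
Proof. by case: T => -[p l] t [?|?]; [right|left]. Qed.

Definition trans_adj (T1 T2 T3 : R * R * R) (x y : R) : Prop :=
  [\/ trans_edge T1 x y, trans_edge T2 x y | trans_edge T3 x y].

Lemma trans_adj_sym T1 T2 T3 x y : trans_adj T1 T2 T3 x y -> trans_adj T1 T2 T3 y x.
Proof.
by case=> /trans_edge_sym; [exact: Or31|exact: Or32|exact: Or33].
Qed.

Definition trans_graph (H : R) T1 T2 T3 : graph R :=
  Graph [set x | 0 <= x <= H] (@trans_adj_sym T1 T2 T3).

Lemma trans_graph_swap H T1 T2 T3 : trans_graph H T1 T2 T3 = trans_graph H T2 T1 T3.
Proof.
by apply: graph_ext => //= x y; split=> -[]; by [exact: Or31|exact: Or32|exact: Or33].
Qed.

Lemma trans_graph_rot H T1 T2 T3 : trans_graph H T1 T2 T3 = trans_graph H T2 T3 T1.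
Proof.
by apply: graph_ext => //= x y; split=> -[]; by [exact: Or31|exact: Or32|exact: Or33].
Qed.

Lemma trans_graph_flip H p l t T2 T3 :
  trans_graph H (p, l, t) T2 T3 = trans_graph H (p + t, l, - t) T2 T3.
Proof.
have E x y : trans_edge (p, l, t) x y <-> trans_edge (p + t, l, - t) x y.
  by split=> -[[/andP[x1 x2] ->]|[/andP[x1 x2] ->]]; [right|left|right|left]; split; lra.
apply: graph_ext => //= x y; split=> -[]; try by [exact: Or32|exact: Or33].
  by move=> /E; exact: Or31.
by move=> /E; exact: Or31.
Qed.

(** The inequalities place the moving interval of pair [j] inside the right interval of pair [i],
    written after translation by [- ti]. The inequations exclude loops and coincidences with the
    kept edges, before the slide ([tj]) and after it ([tj - ti]). *)
Lemma trans_slide H pi li ti pj lj tj pk lk tk :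
  0 <= pi -> pi + li <= H -> 0 <= pi + ti -> pi + li + ti <= H ->
  pi <= pj + (tj - ti) -> pj + lj + (tj - ti) <= pi + li ->
  [/\ ti <> 0, tk <> 0, tj <> 0 & tj - ti <> 0] ->
  [/\ tj <> - ti, tj <> tk & tj <> - tk] ->
  [/\ tj - ti <> ti, tj - ti <> tk & tj - ti <> - tk] ->
  reduces (trans_graph H (pi, li, ti) (pj, lj, tj) (pk, lk, tk))
          (trans_graph H (pi, li, ti) (pj, lj, tj - ti) (pk, lk, tk)).
Proof.
move=> Hi1 Hi2 Hi3 Hi4 Hj1 Hj2 [ti0 tk0 tj0 tji0] [tj1 tj2 tj3] [tn1 tn2 tn3].
apply: (@slide_reduces R _ _ _
  (fun x y => trans_edge (pi, li, ti) x y \/ trans_edge (pk, lk, tk) x y)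
  (fun x y z => [/\ pj <= x <= pj + lj, y = x + tj & z = x + (tj - ti)])).
split => /=.
- by move=> x y [] [] [xp ->]; [left; right|left; left|right; right|right; left].
- move=> x y [] [] [_ ->] E; by [apply: ti0; lra|apply: tk0; lra].
- move=> x y Vx Vy; split.
    case=> [Ti|[[xj ->]|[yj ->]]|Tk]; [by left; left| | |by left; right].
    + by right; exists (x + (tj - ti)); left.
    + by right; exists (y + (tj - ti)); right.
  case=> [[Ti|Tk]|[z [[xj -> _]|[yj -> _]]]]; [exact: Or31|exact: Or33| |].
  + by apply: Or32; left.
  + by apply: Or32; right.
- move=> x y Vx Vy; split.
    case=> [Ti|[[xj ->]|[yj ->]]|Tk]; [by left; left| | |by left; right].
    + by right; exists (x + tj); left.
    + by right; exists (y + tj); right.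
  case=> [[Ti|Tk]|[z [[xj _ ->]|[yj _ ->]]]]; [exact: Or31|exact: Or33| |].
  + by apply: Or32; left.
  + by apply: Or32; right.
- move=> x y z [xj -> ->]; split.
  + by move=> E; apply: tj0; lra.
  + by move=> E; apply: tji0; lra.
  + by left; left; split; lra.
  (* [tj - ti <> 0] excludes both a loop after the slide and [tj = ti] here; likewise [tj <> 0]
     excludes [tj - ti = - ti] below. *)
  + case=> -[] [_ E]; [apply: tji0|apply: tj1|apply: tj2|apply: tj3]; lra.
  + case=> -[] [_ E]; [apply: tn1|apply: tj0|apply: tn2|apply: tn3]; lra.
- by move=> x y z [xj -> ->] *; lra.
- by move=> x y z [xj -> ->] *; lra.
- by move=> x y z z' [_ _ ->] [_ _ ->].
- by move=> x y y' z [_ -> _] [_ -> _].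
- by move=> x y z z' [_ E1 _] [_ E2 _]; apply: tj0; lra.
- by move=> x y y' z [_ _ E1] [_ _ E2]; apply: tji0; lra.
Qed.

(** Above [H'] only the right interval of pair [i] remains. It covers all of that part since
    [H - H' <= li], and its partners [x - ti] lie in the kept part since [H - H' <= ti]; so each
    removed point is a leaf. *)
Lemma trans_cut H H' pi li ti pj lj tj pk lk tk :
  0 <= pi -> 0 < ti -> pi + li + ti = H ->
  H' <= H -> H - H' <= ti -> H - H' <= li ->
  pj + lj <= H' -> pj + lj + tj <= H' -> pk + lk <= H' -> pk + lk + tk <= H' ->
  tj <> 0 -> tk <> 0 ->
  reduces (trans_graph H (pi, li, ti) (pj, lj, tj) (pk, lk, tk))
          (trans_graph H' (pi, li - (H - H'), ti) (pj, lj, tj) (pk, lk, tk)).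
Proof.
move=> Hi1 ti0 HE H'H Ht Hl Hj1 Hj2 Hk1 Hk2 tj0 tk0.
apply: (@collapse_reduces _ _ _ (fun x => x - ti)); split => /=.
- by move=> x /= /andP[x0 xH]; lra.
- move=> x y /andP[x0 xH] /andP[y0 yH].
  by split=> -[[[/andP[z1 z2] E]|[/andP[z1 z2] E]]|?|?];
    by [exact: Or32|exact: Or33|apply: Or31; left; split => //; lra
       |apply: Or31; right; split => //; lra].
- move=> x y _ _ [] [] [_ ->] E; by [lra|apply: tj0; lra|apply: tk0; lra].
- move=> x /andP[x0 xH] /negP; rewrite x0 /= -ltNge => H'x.
  by split; [lra|apply: Or31; right; split; lra].
- move=> x y /andP[x0 xH] /negP; rewrite x0 /= -ltNge => H'x _.
  by case=> [] [] [/andP[z1 z2] E]; lra.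
- move=> w; apply: (@sub_finite_set _ _ [set w + ti]) => //= x /= <-.
  by rewrite subrK.
Qed.

Lemma trans_move H H' pi li ti pj lj tj pk lk tk :
  0 <= pi -> 0 < ti -> pi + li + ti = H ->
  H' <= H -> H - H' <= ti -> H - H' <= li ->
  pi + ti <= pj + tj -> pj + lj + tj <= H ->
  pj + lj <= H' -> pk + lk <= H' -> pk + lk + tk <= H' ->
  [/\ tk <> 0, tj <> 0 & tj - ti <> 0] ->
  [/\ tj <> - ti, tj <> tk & tj <> - tk] ->
  [/\ tj - ti <> ti, tj - ti <> tk & tj - ti <> - tk] ->
  reduces (trans_graph H (pi, li, ti) (pj, lj, tj) (pk, lk, tk))
          (trans_graph H' (pi, li - (H - H'), ti) (pj, lj, tj - ti) (pk, lk, tk)).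
Proof.
move=> Hi1 ti0 HE H'H Ht Hl Hj1 Hj2 Hj3 Hk1 Hk2 [tk0 tj0 tji0] tj1 tn1.
have ti_neq0 : ti <> 0 by lra.
apply: (@reduces_trans _ _ (trans_graph H (pi, li, ti) (pj, lj, tj - ti) (pk, lk, tk))).
  by apply: trans_slide => //; lra.
by apply: trans_cut => //; lra.
Qed.

End TranslationGraphs.

(** * The renormalization *)

Section Renormalization.
Variable R : realType.

Lemma set2_eq (x y m n : R) : [set x; y] = [set m; n] ->
  (x = m /\ y = n) \/ (x = n /\ y = m).
Proof.
move=> E.
have : [set m; n] x by rewrite -E; left.
have : [set m; n] y by rewrite -E; right.
have : [set x; y] m by rewrite E; left.
have : [set x; y] n by rewrite E; right.
by move=> [->|->] [->|->] [yE|yE] [xE|xE]; subst; auto.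
Qed.

Lemma identified_byE (p q r s x y : R) : p < q -> q - p = s - r ->
  identified_by (IPair p q r s) x y <-> trans_edge (p, q - p, r - p) x y.
Proof.
move=> pq len; have l0 : 0 < q - p by rewrite subr_gt0.
split=> [[t /= /andP[t0 t1] E]|].
  have b1 : 0 <= t * (q - p) by rewrite mulr_ge0 // ltW.
  have b2 : t * (q - p) <= q - p by rewrite ler_piMl // ltW.
  rewrite -len in E.
  by case: (set2_eq E) => -[-> ->]; [left|right]; split; lra.
have key z w : p <= z <= p + (q - p) -> w = z + (r - p) ->
    exists2 t, 0 <= t <= 1 & z = p + t * (q - p) /\ w = r + t * (s - r).
  move=> /andP[z1 z2] ->; exists ((z - p) / (q - p)).
    by rewrite divr_ge0 ?ler_pdivrMr //=; lra.
  by rewrite -len divfK; [split; lra|rewrite gt_eqF].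
case=> -[xr yE]; have [t t01 [E1 E2]] := key _ _ xr yE; exists t => //=.
  by rewrite E1 E2.
by rewrite E1 E2 setUC.
Qed.

Lemma Gamma_S_abcu (a b c u : R) : 0 < a -> 0 < b -> 0 < c ->
  Gamma (S_abcu a b c u) =
  trans_graph (a + b + c) (0, a, b + c) (0, b, a + c) (u, c, a + b - 2 * u).
Proof.
move=> a0 b0 c0.
have E1 x y : identified_by (IPair 0 a (b + c) (a + b + c)) x y <->
    trans_edge (0, a, b + c) x y.
  by rewrite identified_byE ?subr0 //; lra.
have E2 x y : identified_by (IPair 0 b (a + c) (a + b + c)) x y <->
    trans_edge (0, b, a + c) x y.
  by rewrite identified_byE ?subr0 //; lra.
have E3 x y : identified_by (IPair u (u + c) (a + b - u) (a + b + c - u)) x y <->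
    trans_edge (u, c, a + b - 2 * u) x y.
  rewrite identified_byE; [|lra|lra].
  have -> : u + c - u = c by lra.
  by have -> : a + b - u - u = a + b - 2 * u by lra.
apply: graph_ext => [|x y].
  by apply/seteqP; split => x /=; rewrite /support_interval /= in_itv.
have pairsE i : pairs (S_abcu a b c u) i = nth (IPair 0 0 0 0)
    [:: IPair 0 a (b + c) (a + b + c); IPair 0 b (a + c) (a + b + c);
        IPair u (u + c) (a + b - u) (a + b + c - u)] i by exact: tnth_nth.
split.
  case=> -[[|[|[|//]]] i3]; rewrite pairsE /=.
  - by move=> /E1; exact: Or31.
  - by move=> /E2; exact: Or32.
  - by move=> /E3; exact: Or33.
case=> [/E1|/E2|/E3] Hxy.
- by exists 0; rewrite pairsE.
- by exists 1; rewrite pairsE.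
- by exists (inord 2); rewrite pairsE inordK.
Qed.

Lemma trans_graph_eq (H H' p1 l1 t1 p2 l2 t2 p3 l3 t3 : R) p1' l1' t1' p2' l2' t2' p3' l3' t3' :
  H = H' -> [/\ p1 = p1', l1 = l1' & t1 = t1'] -> [/\ p2 = p2', l2 = l2' & t2 = t2'] ->
  [/\ p3 = p3', l3 = l3' & t3 = t3'] ->
  trans_graph H (p1, l1, t1) (p2, l2, t2) (p3, l3, t3) =
  trans_graph H' (p1', l1', t1') (p2', l2', t2') (p3', l3', t3').
Proof. by move=> -> [-> -> ->] [-> -> ->] [-> -> ->]. Qed.

Local Ltac linear :=
  match goal with |- and3 _ _ _ => split | |- and4 _ _ _ _ => split | _ => idtac end; lra.

(** Valid on a whole cone around the eigenline, where [a / b], [c / b], [u / b] are about 1.746,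
    1.190 and 1.151. On it the order of the interval ends is the same throughout, and every side
    condition of the moves is a linear consequence. Each cut goes down to the next right end. *)
Lemma renormalization (a b c u a' b' c' u' : R) : 0 < b ->
  349 / 200 * b <= a -> a <= 7 / 4 * b -> 19 / 16 * b <= c -> c <= 25 / 21 * b ->
  23 / 20 * b <= u -> u <= 15 / 13 * b ->
  a' = 3 * a + b - c - 4 * u -> b' = - a + 2 * b ->
  c' = - 2 * a - 2 * b + c + 4 * u -> u' = 3 * a + 2 * b - c - 5 * u ->
  reduces (trans_graph (a + b + c) (0, a, b + c) (0, b, a + c) (u, c, a + b - 2 * u))
    (trans_graph (a' + b' + c') (0, a', b' + c') (0, b', a' + c') (u', c', a' + b' - 2 * u')).
Proof.
move=> b0 a1 a2 c1 c2 u1 u2 -> -> -> ->.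
apply: reduces_trans.
  by apply: (@trans_move _ _ (a + b + c - u)); linear.
(* The third pair now leads, and the first one slides along it twice; each of the two cuts removes
   the translation length [a + b - 2 * u]. *)
rewrite 2!trans_graph_rot; apply: reduces_trans.
  by apply: (@trans_move _ _ (c + u)); linear.
apply: reduces_trans.
  by apply: (@trans_move _ _ (c + u - (a + b - 2 * u))); linear.
(* The roles are exchanged: the third pair slides along the first, down to the right end [a] of the
   second. *)
rewrite trans_graph_swap; apply: reduces_trans.
  by apply: (@trans_move _ _ a); linear.
(* The system is now symmetric again, on [0, a], with [b, a', c'] as lengths and
   the second pair in the role of the first. *)
rewrite 2!trans_graph_rot; apply: reduces_trans.
  (* The new end is [b + a' + c' - u']: this is the initial move for [(b, a', c', u')] instead of
     [(a, b, c, u)]. *)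
  by apply: (@trans_move _ _ (b + (3 * a + b - c - 4 * u) + (- 2 * a - 2 * b + c + 4 * u)
                                - (3 * a + 2 * b - c - 5 * u))); linear.
(* The third pair is stored from [u] with the negative translation [u' - u]. Reading it from [u']
   makes the interval at the right end the one that slides. *)
rewrite 2!trans_graph_rot trans_graph_flip trans_graph_swap; apply: reduces_trans.
  by apply: (@trans_move _ _ b); linear.
rewrite 2!trans_graph_rot.
set G := (X in reduces _ X); set G' := (X in reduces X _).
have -> : G' = G; last exact: reduces_refl.
by apply: trans_graph_eq; linear.
Qed.
End Renormalization.

(** * The eigenvalue, its eigenvector, and the passage to thin type *)

Section Spectrum.
Variable R : realType.

Definition eigen_eqs (l a b c u : R) : Prop :=
  [/\ 3 * a + b - c - 4 * u = l * a, - a + 2 * b = l * b,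
      - 2 * a - 2 * b + c + 4 * u = l * c & 3 * a + 2 * b - c - 5 * u = l * u].

Lemma thinM_col4 (l a b c u : R) :
  thinM R *m col4 a b c u = l *: col4 a b c u <->
  eigen_eqs l a b c u.
Proof.
split=> [E|[E0 E1 E2 E3]].
  have E' i : (thinM R *m col4 a b c u) i 0 = (l *: col4 a b c u) i 0 by rewrite E.
  have := E' 0; have := E' 1; have := E' 2; have := E' 3.
  rewrite !mxE !big_ord_recl !big_ord0 !mxE /= => e3 e2 e1 e0.
  by split; [rewrite -e0|rewrite -e1|rewrite -e2|rewrite -e3]; ring.
apply/matrixP => i j; rewrite !mxE !big_ord_recl big_ord0 !mxE /=.
case: i => -[|[|[|[|//]]]] i4 /=; [rewrite -E0|rewrite -E1|rewrite -E2|rewrite -E3]; ring.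
Qed.

(* The characteristic polynomial of [thinM] is [(x - 1) (x^3 - 4 x + 1)]. *)
Lemma eigenvalue_thinM (l : R) : 0 < l < 1 ->
  eigenvalue (thinM R) l <-> l ^+ 3 - 4 * l + 1 = 0.
Proof.
move=> /andP[l0 l1]; split.
  case/eigenvalueP => v E v0.
  have E' j : (v *m thinM R) 0 j = (l *: v) 0 j by rewrite E.
  have := E' 0; have := E' 1; have := E' 2; have := E' 3.
  rewrite !mxE !big_ord_recl !big_ord0 !mxE /=.
  have -> : lift ord0 ord0 = 1 :> 'I_4 by exact: val_inj.
  have -> : lift ord0 (lift ord0 ord0) = 2 :> 'I_4 by exact: val_inj.
  have -> : lift ord0 (lift ord0 (lift ord0 ord0)) = 3 :> 'I_4 by exact: val_inj.
  set x := v 0 ord0; set y := v 0 1; set z := v 0 2; set w := v 0 3 => e3 e2 e1 e0.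
  have wz : w * (1 + l) = 4 * l * z by lra.
  have xE : x = (1 - l) * z - w by lra.
  have yE : y = (3 - l) * x - 2 * z + 3 * w by lra.
  (* [eigenvalue] refers to row vectors. With [x] and [y] substituted, the two remaining equations
     combine to [z] times the characteristic polynomial, up to sign. *)
  have zq : z * ((1 - l) * (l ^+ 3 - 4 * l + 1)) =
      (1 + l) * (x + (2 - l) * y - 2 * z + 2 * w) +
      (1 + 2 * l - l ^+ 2) * (4 * l * z - w * (1 + l)).
    by rewrite yE xE; ring.
  have e1' : x + (2 - l) * y - 2 * z + 2 * w = 0 by lra.
  move: zq; rewrite e1' wz subrr !mulr0 addr0 => /eqP.
  rewrite !mulf_eq0 => /orP[/eqP z0|/orP[/eqP|/eqP//]]; last lra.
  have w0 : w = 0.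
    move: wz; rewrite z0 mulr0 => /eqP; rewrite mulf_eq0 => /orP[/eqP//|/eqP]; lra.
  have x0 : x = 0 by rewrite xE z0 w0; ring.
  have y0 : y = 0 by rewrite yE x0 z0 w0; ring.
  case/eqP: v0; apply/rowP => j; rewrite mxE.
  case: j => -[|[|[|[|//]]]] j4; [rewrite -x0|rewrite -y0|rewrite -z0|rewrite -w0];
    by congr (v 0 _); exact: val_inj.
move=> q0.
apply/eigenvalueP.
(* The relations of the other direction, solved with [z = 1 + l]; the cubic is needed for the second
   coordinate only. *)
exists (\row_j nth 0 [:: 1 - 4 * l - l ^+ 2; (3 - l) * (1 - 4 * l - l ^+ 2) - 2 * (1 + l) + 12 * l;
   1 + l; 4 * l] j).
  apply/rowP => j; rewrite !mxE !big_ord_recl big_ord0 !mxE /=.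
  case: j => -[|[|[|[|//]]]] j4 /=.
  + by ring.
  + apply/eqP; rewrite -subr_eq0; apply/eqP.
    by transitivity ((1 - l) * (l ^+ 3 - 4 * l + 1)); [ring|rewrite q0 mulr0].
  + by ring.
  + by ring.
apply/eqP => /rowP/(_ 3); rewrite !mxE /= => E; lra.
Qed.

(** The cubic [p] is positive at 31/122 and negative at 46/181. Each product below is the difference
    of two values of [p], factored, and its sign contradicts [p l = 0]. *)
Lemma eigenvalue_bounds (l : R) : 0 < l < 1 -> l ^+ 3 - 4 * l + 1 = 0 ->
  31 / 122 <= l <= 46 / 181.
Proof.
move=> /andP[l0 l1] q0; apply/andP; split; rewrite leNgt; apply/negP => hl.
  have : 0 < (31 / 122 - l) * (4 - l ^+ 2 - l * (31 / 122) - (31 / 122) ^+ 2).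
    by apply: mulr_gt0; nra.
  by lra.
have : 0 < (l - 46 / 181) * (4 - l ^+ 2 - l * (46 / 181) - (46 / 181) ^+ 2).
  by apply: mulr_gt0; nra.
by lra.
Qed.

Lemma eigenvalue_uniq (l m : R) : 0 < l < 1 -> 0 < m < 1 ->
  l ^+ 3 - 4 * l + 1 = 0 -> m ^+ 3 - 4 * m + 1 = 0 -> l = m.
Proof.
move=> /andP[l0 l1] /andP[m0 m1] ql qm.
have : (l - m) * (l ^+ 2 + l * m + m ^+ 2 - 4) = 0.
  transitivity ((l ^+ 3 - 4 * l + 1) - (m ^+ 3 - 4 * m + 1)); first by ring.
  by rewrite ql qm subrr.
move=> /eqP; rewrite mulf_eq0 => /orP[|/eqP]; first by rewrite subr_eq0 => /eqP.
by nra.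
Qed.

Lemma eigenvalue_exists : exists2 l : R, 0 < l < 1 & l ^+ 3 - 4 * l + 1 = 0.
Proof.
pose p : {poly R} := 'X ^+ 3 - 4 *: 'X + 1.
have pE x : p.[x] = x ^+ 3 - 4 * x + 1 by rewrite !hornerE.
(* [poly_ivt] expects a change from negative to positive, whence the opposite polynomial. *)
have [||l /andP[l0 l1] /rootP] := @poly_ivt R (- p) (1 / 8) (1 / 2).
- lra.
- by rewrite !hornerN !pE; lra.
- by rewrite hornerN pE => /eqP; rewrite oppr_eq0 => /eqP ql; exists l => //; lra.
Qed.

(** The second equation gives [a = (2 - l) * b], and the sum of the first three gives
    [b = l * (a + b + c)]; with [b = 1 + l] the cubic reduces [c] to [2 - 2 * l], and the third
    equation gives [u]. *)
Lemma eigen_eqs_exists (l : R) : 0 < l < 1 -> l ^+ 3 - 4 * l + 1 = 0 ->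
  exists a b c u, [/\ 0 < a, 0 < b, 0 < c, 0 < u & eigen_eqs l a b c u].
Proof.
move=> /andP[l0 l1] q0.
exists ((2 - l) * (1 + l)), (1 + l), (2 - 2 * l), (1 + 2 * l - l ^+ 2).
split; [by nra|by lra|by lra|by nra|split; [|by ring|by ring|]].
- by apply/eqP; rewrite -subr_eq0 -q0; apply/eqP; ring.
- by apply/eqP; rewrite -subr_eq0 -q0; apply/eqP; ring.
Qed.

Lemma eigen_eqsZ (l a b c u : R) : eigen_eqs l a b c u ->
  eigen_eqs l (l * a) (l * b) (l * c) (l * u).
Proof. by move=> [E1 E2 E3 E4]; split;
  [rewrite -[in RHS]E1|rewrite -[in RHS]E2|rewrite -[in RHS]E3|rewrite -[in RHS]E4]; ring.
Qed.

Section Eigenvector.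
Variables l a b c u : R.
Hypotheses (lb : 31 / 122 <= l <= 46 / 181) (a0 : 0 < a) (b0 : 0 < b) (u0 : 0 < u).
Hypothesis eqs : eigen_eqs l a b c u.

(** Bounding the products [l * x] by multiples of [x] makes the eigenvector equations accessible to
    linear arithmetic. *)
Let near (x : R) : 0 < x -> 31 / 122 * x <= l * x /\ l * x <= 46 / 181 * x.
Proof. by move: lb => /andP[l1 l2] x0; rewrite !ler_wpM2r // ltW. Qed.

Lemma eigenvector_ratios :
  [/\ 349 / 200 * b <= a, a <= 7 / 4 * b, 19 / 16 * b <= c & c <= 25 / 21 * b] /\
  23 / 20 * b <= u /\ u <= 15 / 13 * b.
Proof.
have [a1 a2] := near a0; have [b1 b2] := near b0; have [u1 u2] := near u0.
by case: eqs => E1 E2 _ E4; split; [split|split]; lra.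
Qed.

Lemma eigenvector_approx : a + b + c = 1 ->
  [/\ `|a - 444%:R / 1000%:R| < 1 / 1000%:R, `|b - 254%:R / 1000%:R| < 1 / 1000%:R,
      `|c - 302%:R / 1000%:R| < 1 / 1000%:R & `|u - 292%:R / 1000%:R| < 1 / 1000%:R].
Proof.
have [a1 a2] := near a0; have [b1 b2] := near b0; have [u1 u2] := near u0.
by case: eqs => E1 E2 _ E4 abc; rewrite !ltr_norml; split; lra.
Qed.

End Eigenvector.

Lemma S_abcu_pairs (a b c u : R) i : pairs (S_abcu a b c u) i = nth (IPair 0 0 0 0)
    [:: IPair 0 a (b + c) (a + b + c); IPair 0 b (a + c) (a + b + c);
        IPair u (u + c) (a + b - u) (a + b + c - u)] i.
Proof. exact: tnth_nth. Qed.

Lemma S_abcu_iis (a b c u : R) : 0 < a -> 0 < b -> 0 < c -> 0 < u -> u < a + b ->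
  is_iis (S_abcu a b c u).
Proof.
move=> a0 b0 c0 u0 uab; split=> [/=|i]; first lra.
have sub p q : 0 <= p -> q <= a + b + c ->
    `[p, q] `<=` support_interval (S_abcu a b c u).
  move=> p0 qH x; rewrite /support_interval /= !in_itv /= => /andP[x1 x2].
  by rewrite (le_trans p0) //= (le_trans x2).
rewrite S_abcu_pairs; case: i => -[|[|[|//]]] i3 /=; split; try (by apply: sub; lra); lra.
Qed.

Lemma S_abcu_symmetric (a b c u : R) : symmetric_iis (S_abcu a b c u).
Proof. by move=> i; rewrite S_abcu_pairs; case: i => -[|[|[|//]]] i3 /=; ring. Qed.

Lemma translate0 n (S : iis R n) : translate S 0 = S.
Proof.
case: S => A B p; rewrite /translate /= !addr0; congr Defs.IIS; apply/funext => i.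
by case: (p i) => *; rewrite !addr0.
Qed.

(** The common interval is the whole support of [S']. *)
Lemma reduces_equivalent n m (S : iis R n) (S' : iis R m) : lo S' < hi S' ->
  reduces (Gamma S) (Gamma S') -> equivalent S S'.
Proof.
move=> lohi [V21 orb eqv]; exists 0, (lo S'), (hi S'); rewrite translate0; split => //.
- by move=> x Sx; split => //; exact: V21.
- split=> x Sx; last by exists x; split => //; split => //; exact: rt_refl.
  by have [y Sy xy] := orb _ Sx; exists y; split => //; split => //; exact: V21.
- by move=> x Sx; apply: vertex_equivalentW; exact: eqv.
Qed.

Lemma S_abcu_reduces (l a b c u : R) k : 31 / 122 <= l <= 46 / 181 ->
  0 < a -> 0 < b -> 0 < c -> 0 < u -> eigen_eqs l a b c u ->
  reduces (Gamma (S_abcu a b c u))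
    (Gamma (S_abcu (l ^+ k * a) (l ^+ k * b) (l ^+ k * c) (l ^+ k * u))).
Proof.
move=> lb; have l0 : 0 < l by lra.
elim: k a b c u => [|k IHk] a b c u a0 b0 c0 u0 eqs.
  by rewrite expr0 !mul1r; exact: reduces_refl.
have [[r1 r2 r3 r4] [r5 r6]] := eigenvector_ratios lb a0 b0 u0 eqs.
(* One renormalization contributes a factor [l]; the induction hypothesis then applies to the scaled
   eigenvector. *)
rewrite exprSr -!mulrA.
apply: reduces_trans (IHk _ _ _ _ _ _ _ _ (eigen_eqsZ eqs)); try exact: mulr_gt0.
rewrite !Gamma_S_abcu ?mulr_gt0 //; case: eqs => E1 E2 E3 E4.
by apply: renormalization.
Qed.

Lemma S_abcu_thin (l a b c u : R) : 31 / 122 <= l <= 46 / 181 ->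
  0 < a -> 0 < b -> 0 < c -> 0 < u -> eigen_eqs l a b c u ->
  thin_type (S_abcu a b c u).
Proof.
move=> lb a0 b0 c0 u0 eqs eps eps0.
have l0 : 0 < l by lra.
have H0 : 0 < a + b + c by rewrite !addr_gt0.
have [k kE] : exists k, l ^+ k * (a + b + c) < eps.
  have l1 : `|l| < 1 by rewrite gtr0_norm //; lra.
  have /cvgrPdist_lt/(_ (eps / (a + b + c))) := cvg_expr l1.
  rewrite divr_gt0 // => /(_ isT)[k _ /(_ k (leqnn k))] /=.
  rewrite sub0r normrN gtr0_norm ?exprn_gt0 // ltr_pdivlMr // => kE.
  by exists k.
have lk0 : 0 < l ^+ k by rewrite exprn_gt0.
have [[r1 r2 r3 r4] [r5 r6]] := eigenvector_ratios lb a0 b0 u0 eqs.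
exists 3, (S_abcu (l ^+ k * a) (l ^+ k * b) (l ^+ k * c) (l ^+ k * u)); split.
- apply: S_abcu_iis; rewrite ?mulr_gt0 // -mulrDr ltr_pM2l //; lra.
- apply: reduces_equivalent; last exact: S_abcu_reduces.
  by rewrite /= -!mulrDr mulr_gt0.
- by rewrite /= subr0 -!mulrDr.
Qed.

End Spectrum.

Theorem proposition1 (R : realType) :
  exists lambda : R,
    [/\ unique (fun l : R => eigenvalue (thinM R) l /\ 0 < l < 1) lambda,
        `|lambda - 254%:R / 1000%:R| < 1 / 1000%:R,
        (exists a b c u : R,
          [/\ 0 < a, 0 < b, 0 < c, 0 < u
            & thinM R *m col4 a b c u = lambda *: col4 a b c u])
      & forall a b c u : R,
          0 < a -> 0 < b -> 0 < c -> 0 < u ->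
          thinM R *m col4 a b c u = lambda *: col4 a b c u ->
          [/\ is_iis (S_abcu a b c u),
              symmetric_iis (S_abcu a b c u),
              thin_type (S_abcu a b c u)
            & a + b + c = 1 ->
              [/\ `|a - 444%:R / 1000%:R| < 1 / 1000%:R,
                  `|b - 254%:R / 1000%:R| < 1 / 1000%:R,
                  `|c - 302%:R / 1000%:R| < 1 / 1000%:R
                & `|u - 292%:R / 1000%:R| < 1 / 1000%:R]]].
Proof.
have [l l01 ql] := eigenvalue_exists R; have lb := eigenvalue_bounds l01 ql.
exists l; split.
- split=> [|m [/eigenvalue_thinM + m01]]; first by split => //; apply/eigenvalue_thinM.
  by move=> /(_ m01); exact: eigenvalue_uniq.
- by rewrite ltr_norml; lra.
- have [a [b [c [u [a0 b0 c0 u0 eqs]]]]] := eigen_eqs_exists l01 ql.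
  by exists a, b, c, u; split => //; apply/thinM_col4.
- move=> a b c u a0 b0 c0 u0 /thinM_col4 eqs.
  have [[r1 r2 r3 r4] [r5 r6]] := eigenvector_ratios lb a0 b0 u0 eqs.
  split; [|exact: S_abcu_symmetric|exact: S_abcu_thin lb _ _ _ _ eqs|].
    by apply: S_abcu_iis => //; lra.
  exact: eigenvector_approx lb _ _ _ eqs.
Qed.
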